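(* Let $n,p$ be integers with $p>0$ and $n-2p\ge2$, and let $\mu=(\mu_1,\ldots,\mu_d)\vdash n$ be a partition with $d$ parts, all satisfying $\mu_i\ge p+1$. Then the expected genus of a uniformly randomly chosen bicolored map from $\mathcal{B}_{p,n}(\mu)$ is $\tfrac12$ times $$n-d-H_n-\frac{1}{n+1}\left\{1+\frac{(-1)^{n-d}}{n}+\frac{(-1)^p}{\binom{n}{p-1}}+\frac{(-1)^{n-d-p}}{\binom{n}{p}}\right\}+\sum_{S\subsetneq\{\mu_1,\ldots,\mu_d\}}\frac{(-1)^{d-|S|+n-p-\Sigma_S}}{n\binom{n-p-1}{\Sigma_S}\binom{n-1}{p}},$$ where the sum is over all proper sub-collections $S$ of the parts (i.e. indexed by proper subsets of the index set $\{1,\ldots,d\}$, equal parts being distinguished by their indices, with $S=\emptyset$ allowed), $|S|$ is the number of parts in $S$, and $\Sigma_S$ is the sum of the parts in $S$.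
   Context: $\mathfrak{S}_n$ is the symmetric group on $[n]=\{1,\ldots,n\}$ and $\kappa(\pi)$ is the number of cycles of $\pi$ (fixed points included). A connected (labeled, rooted) bicolored map with $n$ edges is a triple $(\alpha,\beta,\gamma)$ of permutations in $\mathfrak{S}_n$ with $\gamma=\alpha\beta$ such that the group generated by $\alpha,\beta$ acts transitively on $[n]$; cycles of $\alpha,\beta,\gamma$ encode white vertices, black vertices and faces respectively. Its genus $g$ is defined by $\kappa(\alpha)+\kappa(\beta)-n+\kappa(\gamma)=2-2g$. $\mathcal{B}_{p,n}(\mu)$ is the set of connected bicolored maps with $\beta$ of cycle-type $[p,n-p]$ (one cycle of length $p$, one of length $n-p$) and $\alpha$ of cycle-type $\mu$ (equivalently, for counting purposes, with face-type $[p,n-p]$ instead of black vertex degree distribution $[p,n-p]$). $H_n=1+\frac12+\cdots+\frac1n$ is the $n$-th harmonic number. *)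

(* Defs.v *)
From mathcomp Require Import all_boot all_order all_algebra all_fingroup.

Set Implicit Arguments.
Unset Strict Implicit.
Unset Printing Implicit Defensive.

Import GRing.Theory.
Local Open Scope ring_scope.

Definition is_partition (n : nat) (mu : seq nat) : bool :=
  [&& sorted geq mu, all (fun k => 0 < k)%N mu & sumn mu == n].

Definition kappa (n : nat) (s : 'S_n) : nat := #|porbits s|.

(* Cycle types are compared as multisets. *)
Definition has_cycle_type (n : nat) (s : 'S_n) (mu : seq nat) : bool :=
  perm_eq [seq #|pred_of_set c| | c <- enum (porbits s)] mu.

(* The product [alpha * beta] of 'S_n applies alpha first.  With the opposite
   convention gamma would be a conjugate of this one, so its cycle type (hence
   the genus) does not depend on the convention. *)
Definition connected_bicolored_map (n : nat) (m : 'S_n * 'S_n * 'S_n) : bool :=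
  let: (alpha, beta, gamma) := m in
  (gamma == alpha * beta)%g
  && [transitive <<[set alpha; beta]>>%g, on [set: 'I_n] | 'P].

(* The solution g of kappa alpha + kappa beta - n + kappa gamma = 2 - 2 g. *)
Definition genus (n : nat) (m : 'S_n * 'S_n * 'S_n) : rat :=
  let: (alpha, beta, gamma) := m in
  (2 - ((kappa alpha)%:R + (kappa beta)%:R - n%:R + (kappa gamma)%:R)) / 2.

Definition bicolored_maps (p n : nat) (mu : seq nat) :
    {set 'S_n * 'S_n * 'S_n} :=
  [set m | let: (alpha, beta, _) := m in
     [&& connected_bicolored_map m,
         has_cycle_type beta [:: p; (n - p)%N]
       & has_cycle_type alpha mu]].

(* Expectation of X under the uniform distribution on A (0 if A is empty). *)
Definition uniform_expectation (T : finType) (A : {set T}) (X : T -> rat) :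
    rat :=
  (\sum_(x in A) X x) / #|A|%:R.

Definition harmonic_number (n : nat) : rat :=
  \sum_(1 <= k < n.+1) k%:R^-1.

(* Main.v *)
Require Import Defs.
From mathcomp Require Import all_boot all_order all_algebra all_fingroup.
From mathcomp Require Import zify ring lra.

(** A map is a pair [(s, t)] with cycle types [mu] and [p, q], where
    [q = n - p]; its third permutation is [s * t]. Every cycle of [s] is
    longer than [p], so a set stable under both permutations cannot
    separate the two cycles of [t]: the [p]-cycle has no room for a cycle
    of [s] ([no_stable_set]). All such pairs are therefore connected, their
    genus is [(n - d - kappa (s * t)) / 2], and what has to be found is the
    mean number of cycles of [s * t], that is, of [s ^ u * t] for a uniform
    [u].

    Representation theory predicts a closed form. In the mean of
    [x ^ kappa] each irreducible character is weighted by a content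
    polynomial in [x]; differentiating at [x = 1] leaves the trivial
    character, which contributes the harmonic number, and the shapes
    [(a, c + 1, 1^b)], those with exactly one box of content [-1]. The
    values at cycle type [mu] of the characters of these shapes are, up to
    sign, coefficients of the Laurent series
       [chi mu = (x - z) / ((x - y) (z - y)) *
                  \prod_i (x ^ mu_i - y ^ mu_i + z ^ mu_i)],
    and their weights are factorials. The outcome is
       [\sum_u kappa (s ^ u * t) = n! H_n - pairing n (chi mu) (halfchi nu)]
    where [pairing n f g] sums [(-1)^b a! b! c! f_abc g_abc] over
    [a + b + c = n - 1]. As [chi] is antisymmetric in [x] and [z], it is
    enough to keep in the second factor one of the two poles of the kernel,
    up to sign [1 / (y - z)], which gives [halfchi].

    Here this formula is proved without characters, for [t] with one or two
    cycles ([universal_one], [universal_two]), by induction on the number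
    of points. Inserting a new point [e] after [w] in a cycle of [t] and
    summing over [w] amounts, on the side of [s], to multiplying by a
    transposition [(x y)] and then deleting [x], summed over [x] and [y].
    The effect of this on the cycles of [s] is a cut or a join, so [chi]
    undergoes a second-order differential operator [cutjoinOp]
    ([sum_del_tperm]); that no extra term appears is the partial-fraction
    identity [split_vander]. For the factorial pairing the adjoint of this
    operator is [insertOp] ([pairing_insertOp]), which describes the
    insertion of a point into the cycles of [t]. The boundary term of the
    adjunction counts fixed points and accounts for the step from [H_n] to
    [H_(n+1)]. So the formula holds on average over the places [w] of
    insertion ([sum_defect_insert]); by conjugation all places in one cycle
    are equivalent ([universal_insert]), which isolates a single cycle type
    as long as the other insertions are already known.

    When all parts exceed [p], the coefficients of [halfchi [:: p; q]] at
    nonnegative exponents lie on the lines [a = 0], [a = p] and [a = q],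
    where [chi mu] is explicit: its values on [a = p] are the coefficients
    of [\prod_i ('X ^ mu_i - 1)] ([chi_small_x]), the source of the sum
    over sub-collections of parts, and the other values needed are
    constants. The alternating sums of [k! (n - 1 - k)!] that remain
    telescope ([alt_fact_sum]). *)

Set Implicit Arguments.
Unset Strict Implicit.
Unset Printing Implicit Defensive.

Import Order.TTheory GRing.Theory Num.Theory.
Local Open Scope ring_scope.

(** * Differential operators on formal Laurent series in x, y, z *)

Lemma eq_intr (z1 z2 : int) : z1 = z2 -> z1%:~R = z2%:~R :> rat.
Proof. by move->. Qed.

Ltac decide_indicator :=
  match goal with
  | |- context [nat_of_bool ?x] =>
    first [have -> : x = false by lia | have -> : x = true by lia]
  | |- context [if ?x then _ else _] =>
    first [have -> : x = false by lia | have -> : x = true by lia]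
  end.

Ltac indic := rewrite ?(pmulrn 1) -?(intrN, intrB, intrD); apply: eq_intr; lia.

(** [f a b c] is the coefficient of [x^a y^b z^c]. No finiteness is imposed on
    the support: the poles below have infinite expansions, and the operators
    only combine finitely many coefficients at a time. *)
Definition laurent := int -> int -> int -> rat.

Section Operators.
Implicit Types (f g : laurent) (a b c k j : int) (s : seq nat).

(** Multiplication by the super power sum [P_k = x^k - y^k + z^k]. *)
Definition pmul k f : laurent :=
  fun a b c => f (a - k) b c - f a (b - k) c + f a b (c - k).

Definition pmuls s f : laurent := foldr (fun k : nat => pmul k%:Z) f s.

(** [D = x (d/dx)^2 - (d/dy)^2 y + z (d/dz)^2]. *)
Definition cutjoinOp f : laurent := fun a b c =>
  ((a + 1) * a)%:~R * f (a + 1) b c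
  - ((b + 2) * (b + 1))%:~R * f a (b + 1) c
  + ((c + 1) * c)%:~R * f a b (c + 1).

(** [R = d/dx + d/dy + d/dz]. *)
Definition removeOp f : laurent := fun a b c =>
  (a + 1)%:~R * f (a + 1) b c + (b + 1)%:~R * f a (b + 1) c
  + (c + 1)%:~R * f a b (c + 1).

(** [L = x^2 d/dx + (y^2 d/dy + 2 y) + z^2 d/dz]. *)
Definition insertOp f : laurent := fun a b c =>
  (a - 1)%:~R * f (a - 1) b c + (b + 1)%:~R * f a (b - 1) c
  + (c - 1)%:~R * f a b (c - 1).

(** [W_k], the first-order operator in the commutator [[D, P_k] = k W_k]; its
    [x]-component is [x^(k-1) (2 x d/dx + k - 1)]. *)
Definition joinOp k f : laurent := fun a b c =>
  (2 * a - k + 1)%:~R * f (a - k + 1) b c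
  + (2 * b - k + 3)%:~R * f a (b - k + 1) c
  + (2 * c - k + 1)%:~R * f a b (c - k + 1).

(** Multiplication by [\sum_(1 <= i < k) P_(k-1-i) P_i]: a cycle of length [k]
    loses a point, and the rest falls apart into two cycles. *)
Definition cutOp (k : nat) f : laurent := fun a b c =>
  \sum_(1 <= i < k) pmul (k%:Z - 1 - i%:Z) (pmul i%:Z f) a b c.

(** The four commutators below are all that the combinatorics needs from the
    operators: [[D, P_k] = k W_k], [[R, P_k] = k P_(k-1)],
    [[L, P_k] = k P_(k+1)] and [[W_k, P_j] = 2 j P_(k+j-1)]. *)
Lemma cutjoinOp_pmul k f a b c :
  cutjoinOp (pmul k f) a b c = pmul k (cutjoinOp f) a b c + k%:~R * joinOp k f a b c.
Proof.
rewrite /cutjoinOp /joinOp /pmul.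
rewrite !(addrAC _ (- k) 1) .
ring.
Qed.

Lemma removeOp_pmul k f a b c :
  removeOp (pmul k f) a b c = pmul k (removeOp f) a b c + k%:~R * pmul (k - 1) f a b c.
Proof.
rewrite /removeOp /pmul.
have e (x : int) : x - (k - 1) = x + 1 - k by ring.
rewrite !e !(addrAC _ (- k) 1); ring.
Qed.

Lemma insertOp_pmul k f a b c :
  insertOp (pmul k f) a b c = pmul k (insertOp f) a b c + k%:~R * pmul (k + 1) f a b c.
Proof.
rewrite /insertOp /pmul.
have e (x : int) : x - (k + 1) = x - 1 - k by ring.
rewrite !e !(addrAC _ (- k) (- 1)); ring.
Qed.

Lemma joinOp_pmul k j f a b c :
  joinOp k (pmul j f) a b c =
  pmul j (joinOp k f) a b c + 2 * j%:~R * pmul (k + j - 1) f a b c.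
Proof.
rewrite /joinOp /pmul.
have e (x : int) : x - (k + j - 1) = x - k + 1 - j by ring.
have e' (x : int) : x - j - k + 1 = x - k + 1 - j by ring.
rewrite !e !e'; ring.
Qed.

End Operators.

(** * The action of the operators on the expanded poles *)

Section Poles.
Implicit Types (a b c : int).

(** [1 / (y - z)] expanded for [|y| > |z|]. *)
Definition inv_yz : laurent := fun a b c =>
  [&& a == 0, 0 <= c & b == - c - 1]%:R.
(** [1 / (x - y)] expanded for [|x| > |y|]. *)
Definition inv_xy : laurent := fun a b c =>
  [&& c == 0, 0 <= b & a == - b - 1]%:R.
(** [(x - z) / ((x - y) (z - y))], the kernel that turns products of power sums
    into character values; its partial fractions are the two poles. *)
Definition vander : laurent := fun a b c => - inv_yz a b c - inv_xy a b c.
Definition one_series : laurent := fun a b c => [&& a == 0, b == 0 & c == 0]%:R.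

(** [(x^r - y^r) / (x - y)] is a polynomial, whatever the expansion. *)
Lemma inv_xy_shift (r : nat) a b c :
  inv_xy (a - r%:Z) b c - inv_xy a (b - r%:Z) c =
  [&& c == 0, 0 <= a, 0 <= b & a + b == r%:Z - 1]%:R.
Proof.
rewrite /inv_xy !(pmulrn 1) -intrB; apply: eq_intr.
lia.
Qed.

Lemma cutjoinOp_inv_xy a b c : cutjoinOp inv_xy a b c = 0.
Proof.
rewrite /cutjoinOp /inv_xy !(pmulrn 1) -!intrM -!intrB -!intrD -[RHS]/(0%:~R); apply: eq_intr.
nia.
Qed.

Lemma removeOp_inv_xy a b c : removeOp inv_xy a b c = 0.
Proof.
rewrite /removeOp /inv_xy !(pmulrn 1) -!intrM -!intrD -[RHS]/(0%:~R); apply: eq_intr.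
nia.
Qed.

(** [L] does not annihilate the pole but sends it to the constant [1]. Being
    symmetric in [x] and [z], this is invisible in a pairing with an
    antisymmetric series. *)
Lemma insertOp_inv_yz a b c : insertOp inv_yz a b c = one_series a b c.
Proof.
rewrite /insertOp /inv_yz /one_series !(pmulrn 1) -!intrM -!intrD; apply: eq_intr.
nia.
Qed.

Lemma cutjoinOp_inv_yz a b c : cutjoinOp inv_yz a b c = 0.
Proof.
rewrite /cutjoinOp /inv_yz !(pmulrn 1) -!intrM -!intrB -!intrD -[RHS]/(0%:~R); apply: eq_intr.
nia.
Qed.

Lemma removeOp_inv_yz a b c : removeOp inv_yz a b c = 0.
Proof.
rewrite /removeOp /inv_yz !(pmulrn 1) -!intrM -!intrD -[RHS]/(0%:~R); apply: eq_intr.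
nia.
Qed.

Lemma sum_indic_ge (k : nat) (z : int) : (0 < k)%N ->
  \sum_(1 <= i < k) (z <= i%:Z)%R%:R =
  (if z < 1 then k%:Z - 1 else if z < k%:Z then k%:Z - z else 0)%:~R :> rat.
Proof.
elim: k => // -[|k] IH _; first by rewrite big_geq //; apply: (@eq_intr 0); do ?case: ifP => ?; lia.
rewrite big_nat_recr //= IH // !(pmulrn 1) -intrD; apply: eq_intr.
by do ?case: ifP => ?; lia.
Qed.

Lemma sum_indic_eq (k : nat) (z : int) : (0 < k)%N ->
  \sum_(1 <= i < k) (i%:Z == z)%:R = (1 <= z < k%:Z)%R%:R :> rat.
Proof.
elim: k => // -[|k] IH _; first by rewrite big_geq // !(pmulrn 1); apply: (@eq_intr 0); lia.
rewrite big_nat_recr //= IH // !(pmulrn 1) -intrD; apply: eq_intr; lia.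
Qed.

(** Applied to the single pole [1 / (x - y)], cutting and [W_k] differ by twice
    the complete homogeneous polynomial of degree [k - 2] in [x], [y], [z]. The
    correction is symmetric, so it cancels in the difference of the poles at
    [x] and at [z]. *)
Lemma split_inv_xy (k : nat) a b c : (0 < k)%N ->
  cutOp k inv_xy a b c =
  joinOp k inv_xy a b c + 2 * [&& 0 <= a, 0 <= b, 0 <= c & a + b + c == k%:Z - 2]%:R.
Proof.
move=> k0; have mE (r : nat) a' b' c' : pmul r%:Z inv_xy a' b' c' =
  [&& c' == 0, 0 <= a', 0 <= b' & a' + b' == r%:Z - 1]%:R + inv_xy a' b' (c' - r%:Z).
  by rewrite -inv_xy_shift.
(* Each product is a combination of indicators that are monotone or punctual in
   [i], plus a term independent of [i]. *)
transitivity (\sum_(1 <= i < k) (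
   [&& c == 0, 0 <= b & a + b == k%:Z - 2]%:R * (k%:Z - 1 - a <= i%:Z)%R%:R
   - [&& c == 0, 0 <= a & a + b == k%:Z - 2]%:R * (k%:Z - 1 - b <= i%:Z)%R%:R
   + [&& 0 <= a, 0 <= b & a + b + c == k%:Z - 2]%:R * (i%:Z == k%:Z - 1 - c)%R%:R
   + [&& 0 <= a, 0 <= b & a + b + c == k%:Z - 2]%:R * (i%:Z == c)%:R
   + inv_xy a b (c - k%:Z + 1) : rat)).
  apply: eq_big_nat => i /andP[i1 ik].
  have [u ku] : exists u : nat, k = (u + i + 1)%N by exists (k - i - 1)%N; lia.
  have -> : k%:Z - 1 - i%:Z = u%:Z by rewrite ku !PoszD; ring.
  rewrite {1}/pmul !mE.
  rewrite [_ + inv_xy a (b - _) _]addrC opprD.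
  set X := inv_xy (a - _) _ _; set Y := inv_xy a (b - _) _.
  have -> : Y = X - [&& c - i%:Z == 0, 0 <= a, 0 <= b & a + b == u%:Z - 1]%:R.
    by rewrite -inv_xy_shift /X /Y; ring.
  have -> : c - u%:Z - i%:Z = c - k%:Z + 1 by rewrite ku !PoszD; ring.
  rewrite -!natrM !mulnb; set Z := inv_xy _ _ _.
  set p1 := _%:R; set p2 := _%:R; set p3 := _%:R; set p4 := _%:R.
  set q1 := _%:R; set q2 := _%:R; set q3 := _%:R; set q4 := _%:R.
  have e1 : p1 = q1 by rewrite /p1 /q1; congr (nat_of_bool _)%:R; lia.
  have e2 : p2 = q4 by rewrite /p2 /q4; congr (nat_of_bool _)%:R; lia.
  have e3 : p3 = q2 by rewrite /p3 /q2; congr (nat_of_bool _)%:R; lia.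
  have e4 : p4 = q3 by rewrite /p4 /q3; congr (nat_of_bool _)%:R; lia.
  by rewrite e1 e2 e3 e4; ring.
rewrite !big_split /= sumrN -!mulr_sumr !sum_indic_ge // !sum_indic_eq //.
rewrite sumr_const_nat /joinOp /inv_xy.
have kE : (k - 1)%:R = (k%:Z - 1)%:~R :> rat by rewrite (pmulrn 1); apply: eq_intr; lia.
rewrite -[X in _ + X = _]mulr_natl kE.
have [D|D] := eqVneq (a + b + c) (k%:Z - 2); last first.
  do !decide_indicator.
  by rewrite /= !mulr0n; ring.
have -> : a = k%:Z - 2 - b - c by lia.
have [c0|c0|c0] := ltrgtP 0 c.
- have [b0|b0] := lerP 0 b; have [a0|a0] := lerP 0 (k%:Z - 2 - b - c);
  have [ck|ck] := eqVneq c (k%:Z - 1); try lia;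
  by do !decide_indicator; rewrite /= ?mulr0n ?mulr1n ?ck; ring.
- by do !decide_indicator; rewrite /= ?mulr0n ?mulr1n; ring.
- have [b0|b0] := lerP 0 b; have [bk|bk] := lerP (k%:Z - 1) b;
  have [k1|k1] := eqVneq k 1%N; try lia;
  by do !decide_indicator; rewrite /= ?mulr0n ?mulr1n -?c0 ?k1; ring.
Qed.

(** The formal delta series: the difference of the two expansions of
    [1 / (y - z)]. It bridges the regions [|y| > |z|] and [|z| > |y|], and is
    invariant under exchanging powers of [y] and [z]. *)
Definition pole_yz : laurent := fun a b c => ((a == 0) && (b + c == - 1))%:R.

Lemma pole_yz_shift (r : nat) a b c : pole_yz a (b - r%:Z) c = pole_yz a b (c - r%:Z).
Proof. by rewrite /pole_yz; congr (nat_of_bool _)%:R; lia. Qed.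

Lemma inv_yz_eq a b c : inv_yz a b c = pole_yz a b c - inv_xy c b a.
Proof.
rewrite /inv_yz /pole_yz /inv_xy !(pmulrn 1) -intrB; apply: eq_intr; lia.
Qed.

(** Once the second pole is expanded like the first one with [x] and [z]
    exchanged, [split_inv_xy] applies to both. *)
Lemma vander_eq a b c :
  vander a b c = inv_xy c b a - pole_yz a b c - inv_xy a b c.
Proof. by rewrite /vander inv_yz_eq; ring. Qed.

Lemma joinOp_pole_yz (k : nat) a b c :
  joinOp k pole_yz a b c = (k%:Z - 1)%:~R * pole_yz (a - k%:Z + 1) b c.
Proof.
rewrite /joinOp.
have e (x : int) : x - k%:Z + 1 = x + 1 - k%:Z by ring.
rewrite !(e b) !(e c) pole_yz_shift /pole_yz.
have -> : (b + (c + 1 - k%:Z) == - 1) = (b + c == k%:Z - 2) by lia.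
have -> : (b + 1 + (c - k%:Z) == - 1) = (b + c == k%:Z - 2) by lia.
have [a0|a0] := eqVneq a 0; last first.
  rewrite /= !mulr0n; have [k1|_] := eqVneq (a - k%:Z + 1) 0.
    have -> : 2 * a - k%:Z + 1 = k%:Z - 1 by lia.
    by ring.
  by rewrite /=; ring.
have [k1|k1] := eqVneq (a - k%:Z + 1) 0.
  have -> : k%:Z - 2 = - 1 by lia.
  have -> : k%:Z = 1 by lia.
  rewrite a0; case: eqP => [h|h] /=; last by ring.
  have -> : b = - c - 1 by lia.
  by ring.
rewrite a0 /=; case: eqP => [h|h] /=; last by ring.
have -> : b = k%:Z - 2 - c by lia.
by ring.
Qed.

Lemma split_pole_yz (k : nat) a b c : (0 < k)%N ->
  cutOp k pole_yz a b c = joinOp k pole_yz a b c.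
Proof.
move=> k0; rewrite joinOp_pole_yz /cutOp.
have mU (r : nat) a' b' c' : pmul r%:Z pole_yz a' b' c' = pole_yz (a' - r%:Z) b' c'.
  by rewrite /pmul pole_yz_shift; ring.
rewrite (eq_big_nat _ _ (F2 := fun=> pole_yz (a - k%:Z + 1) b c)).
  rewrite sumr_const_nat -mulr_natl; congr (_ * _).
  by rewrite (pmulrn 1); apply: eq_intr; lia.
move=> i /andP[i1 ik].
have [u ku] : exists u : nat, k = (u + i + 1)%N by exists (k - i - 1)%N; lia.
have -> : k%:Z - 1 - i%:Z = u%:Z by rewrite ku !PoszD; ring.
rewrite {1}/pmul !mU pole_yz_shift ku !PoszD.
have -> : a - (u%:Z + i%:Z + 1) + 1 = a - u%:Z - i%:Z by ring.
by ring.
Qed.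

(** [W_k] acts on the kernel as multiplication by
    [\sum_(1 <= i < k) P_(k-1-i) P_i]. This is what turns the differential
    operator into the operation of cutting cycles. *)
Lemma split_vander (k : nat) a b c : (0 < k)%N ->
  cutOp k vander a b c = joinOp k vander a b c.
Proof.
move=> k0; transitivity (cutOp k inv_xy c b a - cutOp k pole_yz a b c - cutOp k inv_xy a b c).
  rewrite /cutOp -!sumrB; apply: eq_bigr => i _.
  by rewrite /pmul !vander_eq; ring.
rewrite !split_inv_xy // split_pole_yz // /joinOp !vander_eq.
have -> : [&& 0 <= c, 0 <= b, 0 <= a & c + b + a == k%:Z - 2] =
  [&& 0 <= a, 0 <= b, 0 <= c & a + b + c == k%:Z - 2] by lia.
by ring.
Qed.

Lemma cutjoinOp_vander a b c : cutjoinOp vander a b c = 0.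
Proof.
have -> : cutjoinOp vander a b c = - cutjoinOp inv_yz a b c - cutjoinOp inv_xy a b c.
  by rewrite /cutjoinOp /vander; ring.
by rewrite cutjoinOp_inv_yz cutjoinOp_inv_xy oppr0 subr0.
Qed.

Lemma removeOp_vander a b c : removeOp vander a b c = 0.
Proof.
have -> : removeOp vander a b c = - removeOp inv_yz a b c - removeOp inv_xy a b c.
  by rewrite /removeOp /vander; ring.
by rewrite removeOp_inv_yz removeOp_inv_xy oppr0 subr0.
Qed.

End Poles.

(** * The character series *)

Section CharacterSeries.
Implicit Types (f g : laurent) (a b c : int) (s t r : seq nat) (j k : nat).

(** Up to sign, the coefficient of [x^a y^b z^c] for [a > c >= 0], [b >= 0] and
    [a + b + c = sumn s - 1] is the value at cycle type [s] of the irreducible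
    character of shape [(a, c + 1, 1^b)]. *)
Definition chi s : laurent := pmuls s vander.

Lemma eq_pmul (k : int) f g : (forall a b c, f a b c = g a b c) ->
  forall a b c, pmul k f a b c = pmul k g a b c.
Proof. by move=> fg a b c; rewrite /pmul !fg. Qed.

Lemma pmulC (k j : int) f a b c :
  pmul k (pmul j f) a b c = pmul j (pmul k f) a b c.
Proof. by rewrite /pmul !(addrAC _ (- k) (- j)); ring. Qed.

Lemma pmul0 f a b c : pmul 0 f a b c = f a b c.
Proof. by rewrite /pmul !subr0; ring. Qed.

Lemma pmuls_rem s k f a b c : k \in s ->
  pmuls s f a b c = pmul k%:Z (pmuls (rem k s) f) a b c.
Proof.
elim: s a b c => //= j s IH a b c; rewrite inE eq_sym.
case: eqVneq => [->//|jk] /= ks.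
by rewrite (eq_pmul _ (fun a b c => IH a b c ks)) pmulC.
Qed.

Lemma perm_pmuls s t f : perm_eq s t ->
  forall a b c, pmuls s f a b c = pmuls t f a b c.
Proof.
elim: s t => [|k s IH] t st a b c.
  by move: st; rewrite perm_sym => /perm_nilP ->.
have kt : k \in t by rewrite -(perm_mem st) mem_head.
rewrite (pmuls_rem _ _ _ _ kt) /=; apply: eq_pmul; apply: IH.
by rewrite -(perm_cons k) (perm_trans st) // perm_to_rem.
Qed.

Lemma perm_rem k s t : perm_eq s t -> perm_eq (rem k s) (rem k t).
Proof.
move=> st; case: (boolP (k \in s)) => ks; last first.
  by rewrite !rem_id // -(perm_mem st).
have kt : k \in t by rewrite -(perm_mem st).
rewrite -(perm_cons k) perm_sym -(permPl (perm_to_rem kt)) perm_sym.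
by rewrite -(permPl (perm_to_rem ks)).
Qed.

Lemma perm_rem_cons k j s : j \in s -> perm_eq (rem j (k :: s)) (k :: rem j s).
Proof.
move=> js; rewrite -(perm_cons j).
rewrite perm_sym (perm_trans _ (perm_to_rem _)) ?inE ?js ?orbT //.
by rewrite (perm_catCA [:: j] [:: k]) /= perm_cons perm_sym perm_to_rem.
Qed.

Lemma pmul_add (k : int) f g a b c :
  pmul k (fun a b c => f a b c + g a b c) a b c = pmul k f a b c + pmul k g a b c.
Proof. by rewrite /pmul; ring. Qed.

Lemma pmul_lin (k : int) (x : rat) f g a b c :
  pmul k (fun a b c => f a b c + x * g a b c) a b c
  = pmul k f a b c + x * pmul k g a b c.
Proof. by rewrite /pmul; ring. Qed.

Lemma pmul_sum i (I : Type) (r : seq I) (w : I -> rat) (F : I -> laurent) a b c :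
  pmul i%:Z (fun a b c => \sum_(x <- r) w x * F x a b c) a b c
  = \sum_(x <- r) w x * pmul i%:Z (F x) a b c.
Proof.
rewrite /pmul -sumrB -big_split /=; apply: eq_bigr => x _; ring.
Qed.

Lemma pmul_cutOp i k f a b c :
  pmul i%:Z (cutOp k f) a b c = cutOp k (pmul i%:Z f) a b c.
Proof.
rewrite /cutOp /pmul -sumrB -big_split /=; apply: eq_bigr => u _.
rewrite !(addrAC _ (- (k%:Z - 1 - u%:Z)) (- i%:Z)) !(addrAC _ (- u%:Z) (- i%:Z)).
by rewrite !(addrAC _ (- (k%:Z - 1 - u%:Z)) (- i%:Z)); ring.
Qed.

(** Moving [W_k] through the factors [P_j] produces one join with each part
    [j]; what is left acts on the kernel and becomes the cuts. *)
Lemma joinOp_chi k s a b c : (0 < k)%N ->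
  joinOp k (chi s) a b c = cutOp k (chi s) a b c
    + 2 * \sum_(j <- s) j%:R * pmul (k%:Z + j%:Z - 1) (chi (rem j s)) a b c.
Proof.
move=> k0; elim: s a b c => [|i s IH] a b c.
  by rewrite big_nil mulr0 addr0 split_vander.
rewrite joinOp_pmul (eq_pmul _ IH) big_cons [rem i _]/= eqxx.
have -> : pmul i%:Z (fun a b c => cutOp k (chi s) a b c
    + 2 * \sum_(j <- s) j%:R * pmul (k%:Z + j%:Z - 1) (chi (rem j s)) a b c) a b c
  = cutOp k (chi (i :: s)) a b c + 2 * \sum_(j <- s) j%:R *
     pmul (k%:Z + j%:Z - 1) (chi (rem j (i :: s))) a b c.
  rewrite -pmul_cutOp.
  have -> : \sum_(j <- s) j%:R * pmul (k%:Z + j%:Z - 1) (chi (rem j (i :: s))) a b c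
    = pmul i%:Z (fun a b c => \sum_(j <- s) j%:R *
        pmul (k%:Z + j%:Z - 1) (chi (rem j s)) a b c) a b c.
    rewrite pmul_sum; apply: eq_big_seq => j js; congr (_ * _).
    rewrite pmulC; apply: eq_pmul => a' b' c'.
    exact: (perm_pmuls _ (perm_rem_cons i js)).
  exact: pmul_lin.
by rewrite -/(chi s) -pmulrn; ring.
Qed.

(** For each point of each part [k] of [s], one point disappears while the part
    is cut in two, or is joined to another part [j] in one of [j] ways. *)
Definition cutjoin_expansion s : laurent := fun a b c =>
  \sum_(k <- s) k%:R * (cutOp k (chi (rem k s)) a b c
     + \sum_(j <- rem k s) j%:R *
         pmul (k%:Z + j%:Z - 1) (chi (rem j (rem k s))) a b c).

Lemma perm_chi s t : perm_eq s t -> forall a b c, chi s a b c = chi t a b c.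
Proof. exact: perm_pmuls. Qed.

Lemma eq_cutOp k f g : (forall a b c, f a b c = g a b c) ->
  forall a b c, cutOp k f a b c = cutOp k g a b c.
Proof.
by move=> fg a b c; apply: eq_bigr => i _; do 2!apply: eq_pmul => ? ? ?.
Qed.

Lemma rem_head (k : nat) s : rem k (k :: s) = s.
Proof. by rewrite /= eqxx. Qed.

Lemma cutjoinOp_chi s a b c : all (leq 1) s -> cutjoinOp (chi s) a b c = cutjoin_expansion s a b c.
Proof.
elim: s a b c => [|k s IH] a b c.
  by rewrite /cutjoin_expansion big_nil cutjoinOp_vander.
case/andP=> k0 s0; rewrite cutjoinOp_pmul -/(chi s).
rewrite (eq_pmul _ (fun a b c => IH a b c s0)) joinOp_chi // /cutjoin_expansion big_cons rem_head.
set V := cutOp _ _ _ _ _; set S := \sum_(j <- s) _.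
suff -> : \sum_(j <- s) j%:R * (cutOp j (chi (rem j (k :: s))) a b c
     + \sum_(i <- rem j (k :: s)) i%:R *
         pmul (j%:Z + i%:Z - 1) (chi (rem i (rem j (k :: s)))) a b c)
  = pmul k%:Z (cutjoin_expansion s) a b c + k%:R * S.
  by rewrite /cutjoin_expansion -pmulrn; ring.
rewrite /cutjoin_expansion pmul_sum /S mulr_sumr -big_split; apply: eq_big_seq => j js /=.
have pr := perm_rem_cons k js.
rewrite (eq_cutOp _ (perm_chi pr)) (perm_big _ pr) big_cons.
have pr1 : perm_eq (rem k (rem j (k :: s))) (rem j s).
  by rewrite -(rem_head k (rem j s)) perm_rem.
rewrite (eq_pmul _ (perm_chi pr1)).
have -> : j%:Z + k%:Z - 1 = k%:Z + j%:Z - 1 by ring.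
set S1 := \sum_(_ <- _) _.
have -> : S1 = pmul k%:Z (fun a b c => \sum_(i <- rem j s) i%:R *
         pmul (j%:Z + i%:Z - 1) (chi (rem i (rem j s))) a b c) a b c.
  rewrite pmul_sum; apply: eq_big_seq => i irj; congr (_ * _).
  rewrite pmulC; apply: eq_pmul => a' b' c'.
  apply: (perm_pmuls _ (s := _) (t := k :: _)).
  by rewrite (perm_trans (perm_rem _ pr)) // perm_rem_cons.
rewrite -(pmul_cutOp k j (chi (rem j s)) a b c : _ = cutOp j (chi (k :: rem j s)) a b c).
by rewrite pmul_add /=; ring.
Qed.

Lemma removeOp_chi s a b c : 
  removeOp (chi s) a b c = \sum_(k <- s) k%:R * pmul (k%:Z - 1) (chi (rem k s)) a b c.
Proof.
elim: s a b c => [|k s IH] a b c.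
  by rewrite big_nil removeOp_vander.
rewrite removeOp_pmul -/(chi s) (eq_pmul _ IH) big_cons rem_head pmul_sum addrC.
rewrite -pmulrn; congr (_ + _); apply: eq_big_seq => j js; congr (_ * _).
rewrite pmulC; apply: eq_pmul => a' b' c'.
by apply: (perm_pmuls _ (s := k :: _)); rewrite perm_sym perm_rem_cons.
Qed.

Definition top_degree s a b c := (a + b + c == (sumn s)%:Z - 1).

(** At negative exponents of [x] the pole at [x = y] agrees with a delta
    series, for which [x] and [y] may be identified, so that each factor
    collapses to [z^k]; the other pole does not contribute. *)
Lemma chi_neg_x s a b c : a < 0 -> top_degree s a b c ->
  chi s a b c = - (c == (sumn s)%:Z)%:R.
Proof.
rewrite /top_degree; elim: s a b c => [|k s IH] a b c a0 h.
  by rewrite /chi /= /vander /inv_yz /inv_xy; move: h => /= h; indic.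
by rewrite /chi /= /pmul -/(chi s) !IH /=; try (move: h => /=; lia); indic.
Qed.

Lemma chi_neg_z s a b c : c < 0 -> chi s a b c = 0.
Proof.
elim: s a b c => [|k s IH] a b c c0.
  rewrite /chi /= /vander /inv_yz /inv_xy.
  have -> : (0 <= c) = false by lia.
  have -> : (c == 0) = false by lia.
  by rewrite andbF /=; ring.
by rewrite /chi /= /pmul -/(chi s) !IH //; lia.
Qed.

Lemma chi_large_x s a b c : (sumn s)%:Z < a -> top_degree s a b c -> chi s a b c = 0.
Proof.
rewrite /top_degree; elim: s a b c => [|k s IH] a b c a0 h.
  rewrite /chi /= /vander /inv_yz /inv_xy; move: h a0 => /= h a0.
  have -> : (a == 0) = false by lia.
  have -> : [&& c == 0, 0 <= b & a == - b - 1] = false by lia.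
  by rewrite /=; ring.
by rewrite /chi /= /pmul -/(chi s) !IH /=; try (move: h a0 => /=; lia); ring.
Qed.

(** The kernel changes sign when [x] and [z] are exchanged, but its expansion
    does not; the discrepancy consists of delta series, which leave only the
    lines where [a] or [c] is the total degree of the factors. *)
Lemma chi_antisym s a b c : top_degree s a b c ->
  chi s a b c + chi s c b a = - (a == (sumn s)%:Z)%:R - (c == (sumn s)%:Z)%:R.
Proof.
rewrite /top_degree; elim: s a b c => [|k s IH] a b c h.
  by rewrite /chi /= /vander /inv_yz /inv_xy; move: h => /= h; indic.
rewrite /chi /= /pmul -/(chi s).
have h1 := IH (a - k%:Z) b c; have h2 := IH a (b - k%:Z) c.
have h3 := IH a b (c - k%:Z).
rewrite [LHS](_ : _ = (chi s (a - k%:Z) b c + chi s c b (a - k%:Z))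
  - (chi s a (b - k%:Z) c + chi s c (b - k%:Z) a)
  + (chi s a b (c - k%:Z) + chi s (c - k%:Z) b a)); last by ring.
rewrite h1 ?h2 ?h3; try (move: h => /=; lia).
by clear; indic.
Qed.

Lemma chi_top s : chi s (sumn s)%:Z (-1) 0 = -1.
Proof.
elim: s => [|k s IH]; first by [].
case: (posnP k) => [->|k0].
  by rewrite -[LHS]/(pmul 0 (chi s) _ _ _) pmul0.
rewrite /chi /= /pmul -/(chi s) [chi s _ _ (0 - _)]chi_neg_z; last by lia.
rewrite [chi s _ (-1 - _) _]chi_large_x /top_degree; try lia.
have -> : (k + sumn s)%:Z - k%:Z = sumn s by lia.
by rewrite IH; ring.
Qed.

(** The character of shape [(n - 1, 1)]: the number of fixed points minus
    one. *)
Lemma chi_hook1 s : all (leq 1) s -> (0 < sumn s)%N ->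
  chi s ((sumn s)%:Z - 1) 0 0 = (count_mem 1%N s)%:R - 1.
Proof.
elim: s => [|k s IH] //= /andP[k0 s0] _.
rewrite /chi /= /pmul -/(chi s) [chi s _ _ (0 - _)]chi_neg_z; last by lia.
have -> : (k + sumn s)%:Z - 1 - k%:Z = (sumn s)%:Z - 1 by lia.
have -> : chi s ((sumn s)%:Z - 1) 0 0 = (count_mem 1%N s)%:R - 1.
  case: (posnP (sumn s)) => [s00|]; last exact: IH.
  by case: s {IH} s0 s00 => [|[|u] s].
have [->|k1] := eqVneq k 1%N.
  have -> : (1 + sumn s)%:Z - 1 = sumn s by lia.
  by rewrite sub0r (chi_top s) natrD /= mulr1n; ring.
rewrite [(_ + count_mem _ _)%N]add0n chi_large_x /top_degree; try lia; by ring.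
Qed.

(** One of the two poles is enough: pairing with the antisymmetric series [chi]
    does not see symmetric corrections. *)
Definition halfchi s : laurent := pmuls s inv_yz.

Lemma halfchi_neg_x s a b c : a < 0 -> halfchi s a b c = 0.
Proof.
elim: s a b c => [|k s IH] a b c a0.
  rewrite /halfchi /= /inv_yz.
  have -> : (a == 0) = false by lia.
  by rewrite ?andbF.
by rewrite /halfchi /= /pmul -/(halfchi s) !IH //; lia.
Qed.

Lemma halfchi_neg_z s a b c : c < 0 -> halfchi s a b c = 0.
Proof.
elim: s a b c => [|k s IH] a b c a0.
  rewrite /halfchi /= /inv_yz.
  have -> : (0 <= c) = false by lia.
  by rewrite ?andbF.
by rewrite /halfchi /= /pmul -/(halfchi s) !IH //; lia.
Qed.

Lemma halfchi_neg_y s a b c : b < 0 -> top_degree s a b c ->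
  halfchi s a b c = (a == (sumn s)%:Z)%:R.
Proof.
rewrite /top_degree; elim: s a b c => [|k s IH] a b c a0 h.
  by rewrite /halfchi /= /inv_yz; move: h => /= h; indic.
by rewrite /halfchi /= /pmul -/(halfchi s) !IH /=; try (move: h => /=; lia); indic.
Qed.

Lemma pmuls_one_series_sym s a b c : pmuls s one_series a b c = pmuls s one_series c b a.
Proof.
elim: s a b c => [|k s IH] a b c /=.
  by rewrite /one_series; congr (nat_of_bool _)%:R; lia.
rewrite /pmul (IH (a - _)) (IH a) (IH a); ring.
Qed.

Lemma insertOp_pmuls r f a b c :
  insertOp (pmuls r f) a b c = pmuls r (insertOp f) a b c
    + \sum_(k <- r) k%:R * pmul (k%:Z + 1) (pmuls (rem k r) f) a b c.
Proof.
elim: r a b c => [|k r IH] a b c; first by rewrite big_nil addr0.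
rewrite insertOp_pmul -/(pmuls r f) (eq_pmul _ IH) big_cons rem_head pmul_add pmul_sum.
rewrite -pmulrn -[pmuls (k :: r) (insertOp f)]/(pmul k (pmuls r (insertOp f))).
rewrite -addrA; congr (_ + _); rewrite addrC; congr (_ + _).
apply: eq_big_seq => j js; congr (_ * _).
rewrite pmulC; apply: eq_pmul => a' b' c'.
by apply: (perm_pmuls _ (s := k :: _)); rewrite perm_sym perm_rem_cons.
Qed.

End CharacterSeries.

(** * The pairing and its adjunctions *)

Section Pairing.
Implicit Types (f g : laurent) (a b c : int) (s t r : seq nat) (i j k n : nat).

(** The range is the simplex [i + j + k = n - 1]; it is empty for [n = 0], so
    the truncated predecessor is harmless. *)
Definition sum3 n (F : nat -> nat -> nat -> rat) : rat :=
  \sum_(i < n) \sum_(j < n - i) F i j (n.-1 - i - j)%N.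

Lemma eq_sum3 n (F G : nat -> nat -> nat -> rat) :
  (forall i j k, (i + j + k).+1 = n -> F i j k = G i j k) -> sum3 n F = sum3 n G.
Proof.
move=> FG; apply: eq_bigr => i _; apply: eq_bigr => j _; apply: FG.
by have := ltn_ord i; have := ltn_ord j; lia.
Qed.

Lemma sum3_add n (F G : nat -> nat -> nat -> rat) :
  sum3 n (fun i j k => F i j k + G i j k) = sum3 n F + sum3 n G.
Proof. by rewrite /sum3 -big_split; apply: eq_bigr => i _; rewrite big_split. Qed.

Lemma sum3_scale n (x : rat) (F : nat -> nat -> nat -> rat) :
  sum3 n (fun i j k => x * F i j k) = x * sum3 n F.
Proof. by rewrite /sum3 mulr_sumr; apply: eq_bigr => i _; rewrite mulr_sumr. Qed.

(** Splitting off the boundary of the simplex on each of its three sides. *)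
Lemma sum3_shift1 n (F : nat -> nat -> nat -> rat) :
  sum3 n.+1 F = \sum_(j < n.+1) F 0%N j (n - j)%N + sum3 n (fun i j k => F i.+1 j k).
Proof.
rewrite /sum3 big_ord_recl /= subn0; congr (_ + _).
  by apply: eq_bigr => j _; rewrite subn0.
apply: eq_bigr => i _; have -> : (n.+1 - bump 0 i = n - i)%N by rewrite /bump; lia.
by apply: eq_bigr => j _; congr (F _ _ _); rewrite /bump; lia.
Qed.

Lemma sum3_shift2 n (F : nat -> nat -> nat -> rat) :
  sum3 n.+1 F = \sum_(i < n.+1) F i 0%N (n - i)%N + sum3 n (fun i j k => F i j.+1 k).
Proof.
rewrite /sum3; transitivity (\sum_(i < n.+1) (F i 0%N (n - i)%N +
  \sum_(j < n - i) F i j.+1 (n.-1 - i - j)%N)).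
  apply: eq_bigr => i _; have -> : (n.+1 - i = (n - i).+1)%N by have := ltn_ord i; lia.
  rewrite big_ord_recl /= subn0; congr (_ + _).
  by apply: eq_bigr => j _; congr (F _ _ _); rewrite /bump /=; lia.
rewrite big_split; congr (_ + _).
by rewrite big_ord_recr /= subnn big_ord0 addr0.
Qed.

Lemma sum3_shift3 n (F : nat -> nat -> nat -> rat) :
  sum3 n.+1 F = \sum_(i < n.+1) F i (n - i)%N 0%N + sum3 n (fun i j k => F i j k.+1).
Proof.
rewrite /sum3; transitivity (\sum_(i < n.+1) (F i (n - i)%N 0%N +
  \sum_(j < n - i) F i j (n.-1 - i - j).+1)).
  apply: eq_bigr => i _; have -> : (n.+1 - i = (n - i).+1)%N by have := ltn_ord i; lia.
  rewrite big_ord_recr /= subnn addrC; congr (_ + _).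
  apply: eq_bigr => j _; congr (F _ _ _); have := ltn_ord j; lia.
rewrite big_split; congr (_ + _).
by rewrite big_ord_recr /= subnn big_ord0 addr0.
Qed.

Lemma sum3_sym n (F : nat -> nat -> nat -> rat) :
  sum3 n F = sum3 n (fun i j k => F k j i).
Proof.
have E (G : nat -> nat -> nat -> rat) : sum3 n G =
    \sum_(i < n) \sum_(j < n | (i + j < n)%N) G i j (n.-1 - i - j)%N.
  apply: eq_bigr => i _; rewrite (big_ord_widen n (fun j => G i j (n.-1 - i - j)%N)) ?leq_subr //.
  by apply: eq_bigl => j; lia.
rewrite !E (exchange_big_dep xpredT) //= [RHS](exchange_big_dep xpredT) //=.
apply: eq_bigr => j _.
have W (G : nat -> rat) : \sum_(i < n | (i + j < n)%N) G i = \sum_(i < n - j) G i.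
  rewrite (big_ord_widen n G) ?leq_subr //.
  by apply: eq_bigl => i; lia.
rewrite (W (fun i => F i j (n.-1 - i - j)%N)) (W (fun i => F (n.-1 - i - j)%N j i)).
rewrite (reindex_inj rev_ord_inj) /=; apply: eq_bigr => i _.
by congr (F _ _ _); have := ltn_ord i; lia.
Qed.

(** For [a > c] the weight is the derivative at [X = 1] of the product of
    [X + content] over the boxes of the shape [(a, c + 1, 1^b)]. *)
Definition pairing n f g : rat :=
  sum3 n (fun i j k => (-1) ^+ j * (i`! * j`! * k`!)%:R * f i j k * g i j k).

(** For the factorial weight [D] and [L] are adjoint. The boundary of the
    simplex contributes only at the side [b = 0], where [halfchi s] is shifted
    to [b = -1] and has a single nonzero coefficient. *)
Lemma pairing_insertOp n f s : sumn s = n ->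
  pairing n.+1 f (insertOp (halfchi s)) = pairing n (cutjoinOp f) (halfchi s) + n`!%:R * f n 0 0.
Proof.
move=> sn; rewrite /pairing.
pose w i j k : rat := (-1) ^+ j * (i`! * j`! * k`!)%:R * f i j k.
rewrite (@eq_sum3 _ _ (fun i j k =>
    w i j k * ((i%:Z - 1)%:~R * halfchi s (i%:Z - 1) j k)
  + w i j k * ((j%:Z + 1)%:~R * halfchi s i (j%:Z - 1) k)
  + w i j k * ((k%:Z - 1)%:~R * halfchi s i j (k%:Z - 1)))); last first.
  by move=> i j k _; rewrite /w /insertOp; ring.
rewrite 2!sum3_add sum3_shift1 sum3_shift2 sum3_shift3.
rewrite [X in X + sum3 n _ + _]big1; last first.
  by move=> j _; rewrite halfchi_neg_x // !mulr0.
rewrite [X in _ + (X + sum3 n _)]big1; last first.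
  by move=> j _; rewrite halfchi_neg_z // !mulr0.
rewrite big_ord_recr /= big1; last first.
  move=> i _; have li := ltn_ord i.
  have hh : top_degree s i (0 - 1) (n - i)%N by rewrite /top_degree sn; lia.
  rewrite (halfchi_neg_y _ hh) // sn.
  have -> : (i%:Z == n) = false by lia.
  by rewrite !mulr0.
have hh : top_degree s n (0 - 1) (n - n)%N by rewrite /top_degree sn; lia.
rewrite (halfchi_neg_y _ hh) // sn eqxx subnn !add0r /w fact0 expr0 !muln1 !mul1r !mulr1.
set T1 := sum3 n _; set T2 := sum3 n _; set T3 := sum3 n _.
transitivity (T1 + T2 + T3 + n`!%:R * f n 0 0); first by ring.
congr (_ + _); rewrite -!sum3_add; apply: eq_sum3 => i j k e.
rewrite /cutjoinOp !factS exprS.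
have e1 (x : nat) : x.+1%:Z - 1 = x by lia.
have e2 (x : nat) : x.+1%:Z = x%:Z + 1 by lia.
rewrite !e1 !e2 !natrM.
have e3 (x : nat) : x.+1%:R = (x%:Z + 1)%:~R :> rat by rewrite -e2 -pmulrn.
by rewrite !e3; ring.
Qed.

(** For the factorial weight [R] is adjoint to multiplication by [P_1], with
    the same boundary term as in [pairing_insertOp] and the opposite sign. *)
Lemma pairing_pmul1 n f s : sumn s = n ->
  pairing n.+1 f (halfchi (1%N :: s)) = pairing n (removeOp f) (halfchi s) - n`!%:R * f n 0 0.
Proof.
move=> sn; rewrite /pairing.
pose w i j k : rat := (-1) ^+ j * (i`! * j`! * k`!)%:R * f i j k.
rewrite (@eq_sum3 _ _ (fun i j k =>
    w i j k * halfchi s (i%:Z - 1) j k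
  + -1 * (w i j k * halfchi s i (j%:Z - 1) k)
  + w i j k * halfchi s i j (k%:Z - 1))); last first.
  by move=> i j k _; rewrite /w {1}/halfchi /= /pmul -/(halfchi s); ring.
rewrite 2!sum3_add sum3_scale sum3_shift1 sum3_shift2 sum3_shift3.
rewrite [X in X + sum3 n _ + _]big1; last first.
  by move=> j _; rewrite halfchi_neg_x // !mulr0.
rewrite [X in _ + (X + sum3 n _)]big1; last first.
  by move=> j _; rewrite halfchi_neg_z // !mulr0.
rewrite big_ord_recr /= big1; last first.
  move=> i _; have li := ltn_ord i.
  have hh : top_degree s i (0 - 1) (n - i)%N by rewrite /top_degree sn; lia.
  rewrite (halfchi_neg_y _ hh) // sn.
  have -> : (i%:Z == n) = false by lia.
  by rewrite !mulr0.
have hh : top_degree s n (0 - 1) (n - n)%N by rewrite /top_degree sn; lia.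
rewrite (halfchi_neg_y _ hh) // sn eqxx subnn !add0r /w fact0 expr0 !muln1 !mul1r !mulr1.
set T1 := sum3 n _; set T2 := sum3 n _; set T3 := sum3 n _.
transitivity (T1 + -1 * T2 + T3 - n`!%:R * f n 0 0); first by ring.
congr (_ - _); rewrite /T1 /T2 /T3 -sum3_scale -!sum3_add; apply: eq_sum3 => i j k e.
rewrite /removeOp !factS exprS.
have e1 (x : nat) : x.+1%:Z - 1 = x by lia.
have e2 (x : nat) : x.+1%:Z = x%:Z + 1 by lia.
rewrite !e1 !e2 !natrM.
have e3 (x : nat) : x.+1%:R = (x%:Z + 1)%:~R :> rat by rewrite -e2 -pmulrn.
by rewrite !e3; ring.
Qed.

Lemma pairing_chi_sym n t g : sumn t = n -> (forall a b c, g a b c = g c b a) ->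
  pairing n (chi t) g = 0.
Proof.
move=> tn gs; set K := pairing _ _ _.
suff : K = - K by lra.
rewrite /K /pairing [LHS]sum3_sym -[RHS]mulN1r -sum3_scale; apply: eq_sum3 => i j k e.
have hh : top_degree t i j k by rewrite /top_degree tn; lia.
have := chi_antisym hh; rewrite tn.
have -> : (i%:Z == n) = false by lia.
have -> : (k%:Z == n) = false by lia.
rewrite oppr0 addr0 => /eqP; rewrite addrC addr_eq0 => /eqP ->.
by rewrite gs -mulnA mulnCA mulnA mulnC mulnA; ring.
Qed.

Lemma eq_pairing n f (f' : laurent) g (g' : laurent) :
  (forall a b c, f a b c = f' a b c) -> (forall a b c, g a b c = g' a b c) ->
  pairing n f g = pairing n f' g'.
Proof. by move=> ff gg; apply: eq_sum3 => i j k _; rewrite ff gg. Qed.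

Lemma pairing_suml (I : finType) (A : {pred I}) n (F : I -> laurent) g :
  pairing n (fun a b c => \sum_(x in A) F x a b c) g = \sum_(x in A) pairing n (F x) g.
Proof.
rewrite /pairing /sum3 exchange_big; apply: eq_bigr => i _.
rewrite exchange_big; apply: eq_bigr => j _ /=.
by rewrite mulr_sumr mulr_suml.
Qed.

Lemma pairing_sumr (I : finType) (A : {pred I}) n f (G : I -> laurent) :
  pairing n f (fun a b c => \sum_(x in A) G x a b c) = \sum_(x in A) pairing n f (G x).
Proof.
rewrite /pairing /sum3 exchange_big; apply: eq_bigr => i _.
rewrite exchange_big; apply: eq_bigr => j _ /=.
by rewrite mulr_sumr.
Qed.

Lemma pairing_addr n f g (h : laurent) :
  pairing n f (fun a b c => g a b c + h a b c) = pairing n f g + pairing n f h.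
Proof. by rewrite /pairing -sum3_add; apply: eq_sum3 => i j k _; rewrite mulrDr. Qed.

End Pairing.

(** * Cycles of a product with a transposition *)

Section Orbits.
Variable T : finType.
Implicit Types (x y z e : T) (s t : {perm T}) (B : {set T}) (Q : {set {set T}}).

Lemma iter_porbit_neq s x i : (0 < i < #|porbit s x|)%N -> iter i s x != x.
Proof.
case/andP=> i0 ik; have U := uniq_traject_porbit s x.
have := nth_uniq x _ _ U; rewrite size_traject => /(_ i 0%N ik).
rewrite !nth_traject ?(leq_ltn_trans _ ik) //= => -> //.
by rewrite -lt0n.
Qed.

Lemma mem_iter_porbit s x i : iter i s x \in porbit s x.
Proof. by rewrite -permX mem_porbit. Qed.

Lemma eq_porbit s t x : {in porbit s x, s =1 t} -> porbit t x = porbit s x.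
Proof.
move=> st; have E i : iter i t x = iter i s x.
  by elim: i => //= i ->; rewrite st // mem_iter_porbit.
apply/setP => z; apply/porbitP/porbitP => -[i ->]; exists i.
  by rewrite !permX E.
by rewrite !permX E.
Qed.

(** The product starts at [x] like [s] does at [y], until [s] meets [x] or [y]
    again. *)
Lemma tperm_walk s x y m i :
  (forall j, (0 < j < m)%N -> iter j s y \notin [set x; y]) ->
  (0 < i <= m)%N -> iter i (tperm x y * s)%g x = iter i s y.
Proof.
move=> H; elim: i => // -[|i] IH /andP[_ im].
  by rewrite /= permM tpermL.
rewrite [LHS]iterS IH; last by lia.
rewrite permM tpermD //; last first.
- by apply: contraNneq (H i.+1 im) => <-; rewrite !inE eqxx orbT.
- by apply: contraNneq (H i.+1 im) => <-; rewrite !inE eqxx.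
Qed.

Lemma porbit_tperm s x y : y \notin porbit s x ->
  porbit (tperm x y * s)%g x = porbit s x :|: porbit s y.
Proof.
move=> yx.
have sub u v : v \notin porbit s u -> porbit s v \subset porbit (tperm u v * s)%g u.
  move=> vu; apply/subsetP => z; rewrite porbit_traject => /trajectP[i ik ->].
  have W j : (0 < j <= #|porbit s v|)%N -> iter j s v \in porbit (tperm u v * s)%g u.
    move=> jk; suff <- : iter j (tperm u v * s)%g u = iter j s v.
      exact: mem_iter_porbit.
    apply: (tperm_walk _ jk) => l lk.
    rewrite !inE negb_or iter_porbit_neq // andbT.
    by apply: contraNneq vu => <-; rewrite porbit_sym mem_iter_porbit.
  case: i ik => [|i] ik; last by apply: W; rewrite /= ltnW.
  rewrite -[iter 0 s v](iter_porbit s v); apply: W.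
  by rewrite leqnn andbT lt0n card_porbit_neq0.
have xy : x \notin porbit s y by rewrite porbit_sym.
have yt : y \in porbit (tperm x y * s)%g x.
  exact: subsetP (sub _ _ yx) _ (porbit_id _ _).
apply/eqP; rewrite eqEsubset subUset sub // andbT; apply/andP; split; last first.
  have := sub _ _ xy; rewrite tpermC.
  by move: yt; rewrite -eq_porbit_mem => /eqP ->.
apply/subsetP => z /porbitP[i ->]; rewrite permX.
elim: i => [|i]; first by rewrite inE porbit_id.
have st u v : u \in porbit s v -> s u \in porbit s v.
  by rewrite -!eq_porbit_mem => /eqP <-; rewrite -(porbit_perm s 1 u) expg1 .
rewrite iterS permM; set u := iter i _ x => uU.
have [->|nx] := eqVneq u x; first by rewrite tpermL inE (st y y) ?porbit_id ?orbT.
have [->|ny] := eqVneq u y; first by rewrite tpermR inE (st x x) ?porbit_id.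
have -> : tperm x y u = u by rewrite tpermD // eq_sym.
by case/setUP: uU => /st h; rewrite inE h ?orbT.
Qed.

Lemma porbit_tperm_out s x y z : z \notin porbit s x -> z \notin porbit s y ->
  porbit (tperm x y * s)%g z = porbit s z.
Proof.
move=> zx zy; apply: eq_porbit => u uz; rewrite permM tpermD //.
  by apply: contraNneq zx => ->; rewrite porbit_sym.
by apply: contraNneq zy => ->; rewrite porbit_sym.
Qed.

Lemma porbit_fix e s : s e = e -> porbit s e = [set e].
Proof.
move=> se; apply/setP => z; rewrite inE; apply/porbitP/eqP => [[i ->]|->].
  by rewrite permX; elim: i => //= i ->.
by exists 0%N; rewrite expg0 perm1.
Qed.

Lemma perm_on_tperm B x y : x \in B -> y \in B -> perm_on B (tperm x y).
Proof.
by move=> xB yB; apply: subset_trans (tperm_on _ _) _; rewrite subUset !sub1set xB.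
Qed.

Definition orbs B s : {set {set T}} := [set porbit s x | x in B].

Definition sizes Q : seq nat := [seq #|pred_of_set C| | C <- enum Q].

(** Permutations of a subset [B] are permutations of the whole type supported
    in [B]. This allows removing and adding points without changing the type,
    and makes fixed points outside [B] invisible. *)
Definition ctype B s := sizes (orbs B s).

Lemma sizesU1 (C : {set T}) Q : C \notin Q ->
  perm_eq (sizes (C |: Q)) (#|C| :: sizes Q).
Proof.
move=> CQ; rewrite /sizes -map_cons; apply: perm_map; apply: uniq_perm.
- exact: enum_uniq.
- by rewrite /= mem_enum CQ enum_uniq.
- by move=> x; rewrite inE !mem_enum !inE.
Qed.

Lemma sizesD1 (C : {set T}) Q : C \in Q ->
  perm_eq (sizes Q) (#|C| :: sizes (Q :\ C)).
Proof. by move=> CQ; rewrite -{1}(setD1K CQ) sizesU1 // !inE eqxx. Qed.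

Lemma sizes_rem (C : {set T}) Q : C \in Q ->
  perm_eq (sizes (Q :\ C)) (rem #|C| (sizes Q)).
Proof.
move=> CQ; rewrite -(perm_cons #|C|) -(permPl (sizesD1 CQ)).
apply: perm_to_rem; rewrite (perm_mem (sizesD1 CQ)); exact: mem_head.
Qed.

Lemma mem_orbs B s x : x \in B -> porbit s x \in orbs B s.
Proof. exact: imset_f. Qed.

Lemma porbit_on B s x : perm_on B s -> x \in B -> porbit s x \subset B.
Proof.
move=> sB xB; apply/subsetP => z /porbitP[i ->]; rewrite permX.
by elim: i => //= i; rewrite perm_closed.
Qed.

Lemma orbs_tperm B s x y : perm_on B s -> x \in B -> y \in B ->
  y \notin porbit s x ->
  orbs B (tperm x y * s)%g =
  (porbit s x :|: porbit s y) |: (orbs B s :\ porbit s x :\ porbit s y).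
Proof.
move=> sB xB yB yx; apply/setP => C.
have Uy : porbit (tperm x y * s)%g y = porbit s x :|: porbit s y.
  by rewrite tpermC porbit_tperm 1?porbit_sym // setUC.
rewrite !inE; apply/imsetP/idP.
  case=> z zB ->; have [zx|zx] := boolP (z \in porbit s x :|: porbit s y).
    rewrite -(porbit_tperm yx) in zx *.
    by move: zx; rewrite -eq_porbit_mem => ->.
  move: zx; rewrite inE negb_or => /andP[zx zy].
  by rewrite porbit_tperm_out // !eq_porbit_mem zx zy mem_orbs ?orbT.
case/orP=> [/eqP ->|/and3P[Cy Cx /imsetP[z zB Cz]]].
  by exists x; rewrite ?porbit_tperm.
exists z => //; move: Cx Cy; rewrite Cz !eq_porbit_mem => zx zy.
by rewrite porbit_tperm_out.
Qed.

End Orbits.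

(** * Deleting a point from a permutation *)

Section Deletion.
Variable T : finType.
Implicit Types (x y z e : T) (s t : {perm T}) (B : {set T}) (Q : {set {set T}}).

Lemma sumn_ctype B s : perm_on B s -> sumn (ctype B s) = #|B|.
Proof.
move=> sB; rewrite /ctype /sizes sumnE big_map big_enum /=.
have P : partition (orbs B s) B.
  apply/and3P; split.
  - apply/eqP/setP => x; apply/bigcupP/idP => [[_ /imsetP[z zB ->]]|xB].
      by apply/subsetP; apply: porbit_on.
    by exists (porbit s x); [exact: mem_orbs | exact: porbit_id].
  - apply/trivIsetP => _ _ /imsetP[x xB ->] /imsetP[y yB ->].
    rewrite eq_porbit_mem => xy; rewrite -setI_eq0; apply/eqP/setP => z.
    rewrite !inE; apply/negP => /andP[zx zy]; case/negP: xy.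
    by move: zx zy; rewrite -!eq_porbit_mem => /eqP <-.
  by apply/imsetP => -[x _ /setP /(_ x)]; rewrite porbit_id inE.
by rewrite (card_partition P).
Qed.

Lemma ctype_gt0 B s : all (leq 1) (ctype B s).
Proof.
apply/allP => k /mapP[C]; rewrite mem_enum => /imsetP[x _ ->] ->.
by rewrite lt0n card_porbit_neq0.
Qed.

(** From [x] the product jumps over the arc that leads from [x] to [y], and
    this arc closes up into the cycle of [y]. Both arcs give lower bounds on
    the lengths of the two cycles, and the lengths add up to [k]. *)
Lemma porbit_split s x i (k := #|porbit s x|) : (0 < i < k)%N ->
  let y := iter i s x in let t := (tperm x y * s)%g in
  [/\ y \notin porbit t x, #|porbit t x| = (k - i)%N & #|porbit t y| = i].
Proof.
move=> ik y t; have yx : y != x by apply: iter_porbit_neq.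
have yOx : y \in porbit s x by exact: mem_iter_porbit.
have c1 := porbits_mul_tperm s x y; have c2 := porbits_mul_tperm t x y.
have U := uniq_traject_porbit s x.
have tts : (tperm x y * t)%g = s by rewrite /t mulgA tperm2 mul1g.
(* The two counts of cycles are compatible only if [x] and [y] are
   separated. *)
have {c1 c2} yt : y \notin porbit t x.
  rewrite porbit_sym; move: c1 c2; rewrite /= -/t tts (porbit_sym s) yOx eq_sym yx /=.
  by case: (x \in porbit t y) => //=; lia.
have O : porbit s x = porbit t x :|: porbit t y by rewrite -tts porbit_tperm.
have D : [disjoint porbit t x & porbit t y].
  rewrite -setI_eq0; apply/eqP/setP => z; rewrite !inE; apply/negP => /andP[zx zy].
  case/negP: yt; rewrite porbit_sym.
  by move: zx zy; rewrite -!eq_porbit_mem => /eqP <-.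
have sumk : (#|porbit t x| + #|porbit t y| = k)%N.
  by rewrite /k O cardsU (eqP (_ : _ :&: _ == set0)) ?cards0 ?subn0 // setI_eq0.
have I j l : (j < k)%N -> (l < k)%N -> (iter j s x == iter l s x) = (j == l).
  move=> jk lk; rewrite -(nth_uniq x _ _ U) ?size_traject //.
  by rewrite !nth_traject.
(* [m] consecutive iterates of [x] inside one cycle give a lower bound on its
   length; the last of them may be [x] itself, hence the reduction modulo
   [k]. *)
have big a m z : (forall j, (0 < j <= m)%N -> iter (a + j) s x \in porbit t z) ->
   (a + m <= k)%N -> (m <= #|porbit t z|)%N.
  move=> H am; pose L := [seq iter (a + j) s x | j <- iota 1 m].
  rewrite -(size_iota 1 m) -(size_map (fun j => iter (a + j) s x)) -/L.
  rewrite cardE; apply: uniq_leq_size => [|u /mapP[j]]; last first.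
    by rewrite mem_iota mem_enum => jm ->; apply: H; lia.
  rewrite map_inj_in_uniq ?iota_uniq // => j l; rewrite !mem_iota => jm lm /eqP.
  have kk v : (0 < v <= k)%N -> iter v s x = iter (v %% k) s x.
    move=> /andP[v0]; rewrite leq_eqVlt => /orP[/eqP ->|vk]; last by rewrite modn_small.
    by rewrite modnn iter_porbit.
  rewrite (kk (a + j)%N) ?(kk (a + l)%N); try by clear -jm lm am; lia.
  have k0 : (0 < k)%N by clear -ik; lia.
  rewrite I ?ltn_pmod //.
  have md v : (v <= k)%N -> (v %% k)%N = if v == k then 0%N else v.
    rewrite leq_eqVlt; case: eqVneq => [->|_] /=; first by rewrite modnn.
    by move=> vk; rewrite modn_small.
  have [aj al] : (a + j <= k)%N /\ (a + l <= k)%N by clear -jm lm am; lia.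
  rewrite !md //; clear -jm lm am.
  by case: (_ =P k) => ?; case: (_ =P k) => ? /eqP; lia.
have b1 : (k - i <= #|porbit t x|)%N.
  apply: (big i) => [j jm|]; last by lia.
  suff <- : iter j t x = iter (i + j) s x by exact: mem_iter_porbit.
  rewrite addnC iterD -/y; apply: (tperm_walk _ jm) => l lm.
  have I0 : (iter l s y == x) = false by rewrite /y -iterD (I (l + i)%N 0%N); lia.
  have Ii : (iter l s y == y) = false by rewrite /y -iterD (I (l + i)%N i); lia.
  by rewrite !inE I0 Ii.
have b2 : (i <= #|porbit t y|)%N.
  apply: (big 0%N) => [j jm|]; last by lia.
  suff <- : iter j t y = iter (0 + j) s x by exact: mem_iter_porbit.
  rewrite /t tpermC; apply: (tperm_walk _ jm) => l lm.
  have I0 : (iter l s x == x) = false by rewrite (I l 0%N); lia.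
  have Ii : (iter l s x == y) = false by rewrite (I l i); lia.
  by rewrite !inE I0 Ii.
by split => //; lia.
Qed.

(** [e] is removed from its cycle and left as a fixed point. *)
Definition del e s : {perm T} := (tperm e (s^-1 e) * s)%g.

Lemma del_fix e s : del e s e = e.
Proof. by rewrite permM tpermL permKV. Qed.

Lemma del_id e s : s e = e -> del e s = s.
Proof. by move=> se; rewrite /del -{2}se permK tperm1 mul1g. Qed.

Lemma delK e s : (tperm e (s^-1 e) * del e s)%g = s.
Proof. by rewrite /del mulgA tperm2 mul1g. Qed.

Lemma perm_on_del B e s : perm_on B s -> e \in B -> perm_on (B :\ e) (del e s).
Proof.
move=> sB eB; apply/subsetP => z; rewrite !inE; apply: contraR.
rewrite negb_and negbK => /orP[/eqP ->|zB]; first by rewrite del_fix.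
have wB : s^-1%g e \in B by rewrite perm_closed // perm_onV.
rewrite permM tpermD ?(out_perm sB) //.
  by apply: contraNneq zB => <-.
by apply: contraNneq zB => <-.
Qed.

Lemma orbs_fix B e s : perm_on B s -> e \in B -> s e = e ->
  orbs (B :\ e) s = orbs B s :\ [set e].
Proof.
move=> sB eB se.
have Oe := porbit_fix se.
apply/setP => C; rewrite !inE; apply/imsetP/andP.
  case=> z; rewrite !inE => /andP[ze zB] ->; split; last exact: mem_orbs.
  by rewrite -Oe eq_porbit_mem Oe inE.
case=> Ce /imsetP[z zB Cz]; exists z => //; rewrite !inE zB andbT.
by apply: contraNneq Ce => ze; rewrite Cz ze Oe.
Qed.

(** Deleting a point shortens its cycle by one. When that cycle is a fixed
    point it disappears, in agreement with [P_0 = 1]. *)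
Lemma ctype_del B e s : perm_on B s -> e \in B -> forall a b c,
  chi (ctype (B :\ e) (del e s)) a b c =
  pmul (#|porbit s e|%:Z - 1) (chi (sizes (orbs B s :\ porbit s e))) a b c.
Proof.
move=> sB eB a b c; have [se|se] := eqVneq (s e) e.
  have Oe := porbit_fix se.
  rewrite del_id //.
  by rewrite /ctype orbs_fix // Oe cards1 subrr pmul0.
set w := (s^-1 e)%g; set d := del e s.
have we : w != e by apply: contraNneq se => we; rewrite -{1}we permKV.
have sd : s = (tperm e w * d)%g by rewrite delK.
have dB' : perm_on (B :\ e) d by exact: perm_on_del.
have dB : perm_on B d by apply: subset_trans dB' (subsetDl _ _).
have wB : w \in B by rewrite perm_closed // perm_onV.
have Oe := porbit_fix (del_fix e s); rewrite -/d in Oe.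
have wde : w \notin porbit d e by rewrite Oe inE.
have Os : porbit s e = e |: porbit d w by rewrite {1}sd porbit_tperm // Oe.
have E : orbs B s :\ porbit s e = orbs (B :\ e) d :\ porbit d w.
  rewrite orbs_fix ?del_fix // {1}sd orbs_tperm // Oe -Os.
  apply/setP => C; rewrite !inE; have [->|] //= := eqVneq C (porbit s e).
  apply/esym/negP => /and3P[_ _ /imsetP[z zB]]; rewrite Os => /setP Z.
  have /esym := Z e; rewrite !inE eqxx /= -eq_porbit_mem Oe => /eqP dz.
  by have := Z w; rewrite -dz !inE porbit_id (negPf we).
rewrite E /ctype.
have Ow : porbit d w \in orbs (B :\ e) d by apply: mem_orbs; rewrite !inE we.
rewrite (perm_chi (sizesD1 Ow)) Os cardsU1.
have -> : e \notin porbit d w by rewrite porbit_sym.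
by rewrite -[chi (_ :: _)]/(pmul _ (chi _)) addrC /= PoszD addKr.
Qed.

End Deletion.

(** * The cut and join operators as sums over transpositions *)

Section CutJoin.
Variable T : finType.
Implicit Types (x y z e : T) (s t : {perm T}) (B : {set T}) (Q : {set {set T}}).

Lemma sum_orbs B s Q (G : {set T} -> rat) : perm_on B s -> Q \subset orbs B s ->
  \sum_(x in B | porbit s x \in Q) G (porbit s x) = \sum_(C in Q) #|C|%:R * G C.
Proof.
move=> sB QB; rewrite (partition_big (porbit s) (mem Q)) /=; last by move=> x /andP[].
apply: eq_bigr => C CQ; have /imsetP[z zB Cz] := subsetP QB _ CQ.
rewrite (eq_bigr (fun=> G C)); last by move=> x /andP[_ /eqP ->].
rewrite sumr_const -[LHS]mulr_natl; congr (_%:R * _); apply: eq_card => x.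
rewrite -[LHS]/(((x \in B) && (porbit s x \in Q)) && (porbit s x == C)).
have [xC|xC] := eqVneq (porbit s x) C.
  rewrite andbT -xC porbit_id xC CQ andbT.
  by rewrite (subsetP (porbit_on sB zB)) // -Cz -xC porbit_id.
by rewrite andbF Cz -eq_porbit_mem -Cz (negPf xC).
Qed.

Lemma sum_sizes Q (g : nat -> rat) :
  \sum_(C in Q) #|C|%:R * g #|C| = \sum_(k <- sizes Q) k%:R * g k.
Proof. by rewrite /sizes big_map big_enum. Qed.

Lemma orbs_tperm_rest B s x y : perm_on B s -> x \in B -> y \in B ->
  y \notin porbit s x ->
  orbs B (tperm x y * s)%g :\ (porbit s x :|: porbit s y) =
  orbs B s :\ porbit s x :\ porbit s y.
Proof.
move=> sB xB yB yx; rewrite orbs_tperm // setU1K // !inE; apply/negP => /and3P[_ Ux].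
case/imsetP=> z zB Uz; case/negP: Ux; rewrite Uz eq_porbit_mem.
by rewrite porbit_sym -Uz inE porbit_id.
Qed.

Lemma chi_ctype_join B s x y : perm_on B s -> x \in B -> y \in B ->
  y \notin porbit s x -> forall a b c,
  chi (ctype (B :\ x) (del x (tperm x y * s)%g)) a b c =
  pmul (#|porbit s x|%:Z + #|porbit s y|%:Z - 1)
    (chi (sizes (orbs B s :\ porbit s x :\ porbit s y))) a b c.
Proof.
move=> sB xB yB yx a b c.
have tB : perm_on B (tperm x y * s)%g.
  by rewrite perm_onM ?perm_on_tperm.
rewrite ctype_del // porbit_tperm // orbs_tperm_rest // cardsU.
rewrite (_ : _ :&: _ = set0) ?cards0 ?subn0 //.
apply/setP => z; rewrite !inE; apply/negP => /andP[zx zy].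
case/negP: yx; rewrite porbit_sym.
by move: zx zy; rewrite -!eq_porbit_mem => /eqP <-.
Qed.

Lemma chi_ctype_cut B s x i : perm_on B s -> x \in B ->
  (0 < i < #|porbit s x|)%N -> forall a b c,
  chi (ctype (B :\ x) (del x (tperm x (iter i s x) * s)%g)) a b c =
  pmul (#|porbit s x|%:Z - 1 - i%:Z)
    (pmul i%:Z (chi (sizes (orbs B s :\ porbit s x)))) a b c.
Proof.
move=> sB xB ik a b c; set y := iter i s x; set t := (tperm x y * s)%g.
have [yt tx ty] := porbit_split ik; rewrite -/y -/t in yt tx ty.
have yB : y \in B by apply: subsetP (porbit_on sB xB) _ (mem_iter_porbit _ _ _).
have tB : perm_on B t.
  by rewrite perm_onM ?perm_on_tperm.
have tts : (tperm x y * t)%g = s by rewrite /t mulgA tperm2 mul1g.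
have O : porbit s x = porbit t x :|: porbit t y by rewrite -tts porbit_tperm.
have R : orbs B s :\ porbit s x = orbs B t :\ porbit t x :\ porbit t y.
  by rewrite O -{1}tts orbs_tperm_rest.
rewrite R ctype_del // tx -subzn; last by lia.
have -> : #|porbit s x|%:Z - i%:Z - 1 = #|porbit s x|%:Z - 1 - i%:Z by ring.
apply: eq_pmul => a' b' c'.
have Oy : porbit t y \in orbs B t :\ porbit t x.
  by rewrite !inE mem_orbs // eq_porbit_mem yt.
by rewrite (perm_chi (sizesD1 Oy)) ty.
Qed.

Lemma big_porbit s x (F : T -> rat) :
  \sum_(y in porbit s x) F y = \sum_(0 <= i < #|porbit s x|) F (iter i s x).
Proof.
rewrite -big_enum (perm_big (traject s x #|porbit s x|)) /=.
  rewrite (big_nth x) size_traject; apply: eq_big_nat => i /andP[_ ik].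
  by rewrite nth_traject.
apply: uniq_perm; rewrite ?enum_uniq ?uniq_traject_porbit //.
by move=> y; rewrite mem_enum porbit_traject.
Qed.

(** A point [y] in the cycle of [x] cuts that cycle, any other point joins two
    cycles: these are the two kinds of terms in [cutjoin_expansion]. *)
Lemma sum_del_tperm B s : perm_on B s -> forall a b c,
  \sum_(x in B) \sum_(y in B :\ x)
     chi (ctype (B :\ x) (del x (tperm x y * s)%g)) a b c
  = cutjoinOp (chi (ctype B s)) a b c.
Proof.
move=> sB a b c; rewrite cutjoinOp_chi ?ctype_gt0 // /cutjoin_expansion.
pose g k := cutOp k (chi (rem k (ctype B s))) a b c
   + \sum_(j <- rem k (ctype B s)) j%:R *
       pmul (k%:Z + j%:Z - 1) (chi (rem j (rem k (ctype B s)))) a b c.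
rewrite -/(ctype B s) -[RHS](sum_sizes (orbs B s) g) -(sum_orbs _ sB (subxx _)).
apply: eq_big => [x|x xB]; first by case: (boolP (x \in B)) => //= xB; rewrite mem_orbs.
rewrite {}/g; set C := porbit s x; set k := #|C|.
have CO : C \in orbs B s by exact: mem_orbs.
have pk : perm_eq (sizes (orbs B s :\ C)) (rem k (ctype B s)) by exact: sizes_rem.
have k0 : (0 < k)%N by rewrite lt0n card_porbit_neq0.
rewrite (bigID (mem C)) /=; congr (_ + _).
  transitivity (\sum_(y in C | y != x)
      chi (ctype (B :\ x) (del x (tperm x y * s)%g)) a b c).
    apply: eq_bigl => y; rewrite !inE andbC; case: (boolP (y \in C)) => //= yC.
    by rewrite (subsetP (porbit_on sB xB)) ?andbT.
  rewrite big_mkcondr big_porbit -/C -/k.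
  rewrite big_ltn // /= eqxx add0r.
  apply: eq_big_nat => i ik; rewrite iter_porbit_neq // chi_ctype_cut //.
  by do 2!apply: eq_pmul => ? ? ?; apply: perm_chi.
rewrite -(perm_big _ pk) /=.
rewrite -(sum_sizes _ (fun j => pmul (k%:Z + j%:Z - 1) (chi (rem j (rem k (ctype B s)))) a b c)).
rewrite -(sum_orbs (fun C' : {set T} => pmul (k%:Z + #|C'|%:Z - 1) (chi (rem #|C'| (rem k (ctype B s)))) a b c) sB); last exact: subsetDl.
apply: eq_big => [y|y].
  rewrite !inE eq_porbit_mem -/C; case: (boolP (y \in C)) => yC /=; rewrite ?andbF // andbT.
  have [yx|yx] /= := eqVneq y x; first by case/negP: yC; rewrite yx porbit_id.
  by case: (boolP (y \in B)) => //= yB; rewrite mem_orbs.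
case/andP=> /setD1P[yx yB] yC; rewrite chi_ctype_join //.
apply: eq_pmul; apply: perm_chi.
have yO : porbit s y \in orbs B s :\ C by rewrite !inE mem_orbs // eq_porbit_mem yC.
by rewrite (permPl (sizes_rem yO)) perm_rem.
Qed.

Lemma sum_del B s : perm_on B s -> forall a b c,
  \sum_(x in B) chi (ctype (B :\ x) (del x s)) a b c = removeOp (chi (ctype B s)) a b c.
Proof.
move=> sB a b c; rewrite removeOp_chi.
rewrite -(sum_sizes (orbs B s) (fun k => pmul (k%:Z - 1) (chi (rem k (ctype B s))) a b c)).
rewrite -(sum_orbs (fun C : {set T} => pmul (#|C|%:Z - 1) (chi (rem #|C| (ctype B s))) a b c) sB) //.
apply: eq_big => [x|x xB]; first by case: (boolP (x \in B)) => //= xB; rewrite mem_orbs.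
by rewrite ctype_del //; apply: eq_pmul; apply: perm_chi; apply: sizes_rem; apply: mem_orbs.
Qed.

Lemma sum_fixed B s : perm_on B s ->
  \sum_(x in B) (s x == x)%:R = (count_mem 1%N (ctype B s))%:R :> rat.
Proof.
move=> sB; have E : (count_mem 1%N (ctype B s))%:R = \sum_(k <- ctype B s) k%:R * (k == 1)%N%:R :> rat.
  elim: (ctype B s) => [|k r IH]; first by rewrite big_nil.
  rewrite big_cons /= natrD IH; congr (_ + _).
  by case: eqP => [->|_]; rewrite ?mulr0 ?mulr1.
rewrite E -(sum_sizes (orbs B s) (fun k => (k == 1)%N%:R)).
rewrite -(sum_orbs (fun C : {set T} => (#|C| == 1)%N%:R) sB) //.
apply: eq_big => [x|x xB]; first by case: (boolP (x \in B)) => //= xB; rewrite mem_orbs.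
congr (nat_of_bool _)%:R; apply/eqP/cards1P => [sx|[y Oy]].
  by exists x; exact: porbit_fix.
have := porbit_id s x; have := mem_porbit s 1 x.
by rewrite Oy !inE expg1 => /eqP -> /eqP ->.
Qed.

End CutJoin.

(** * Cycle counts averaged over conjugates *)

Section Averages.
Variable T : finType.
Implicit Types (x y z e : T) (s t u v : {perm T}) (B : {set T}) (Q : {set {set T}}).

Lemma porbitJ s t x : porbit (s ^ t)%g (t x) = t @: porbit s x.
Proof.
apply/setP => z; apply/porbitP/imsetP => [[i ->]|[w /porbitP[i ->] ->]].
  by exists ((s ^+ i)%g x); rewrite ?mem_porbit // -conjXg permJ.
by exists i; rewrite -conjXg permJ.
Qed.

Lemma orbsJ B s t : orbs (t @: B) (s ^ t)%g = [set t @: (C : {set T}) | C in orbs B s].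
Proof.
rewrite /orbs -!imset_comp; apply: eq_imset => x /=.
exact: porbitJ.
Qed.

Lemma ctypeJ B s t : perm_eq (ctype (t @: B) (s ^ t)%g) (ctype B s).
Proof.
rewrite /ctype /sizes orbsJ.
have inj : injective (fun C : {set T} => t @: C) by apply: imset_inj; apply: perm_inj.
rewrite perm_sym.
apply: (@perm_trans _ [seq #|pred_of_set C| | C <- [seq t @: (C : {set T}) | C : {set T} <- enum (orbs B s)]]).
  rewrite -map_comp; apply/seq.permP => a; congr (count a _); apply: eq_map => C /=.
  by rewrite card_imset //; apply: perm_inj.
apply: perm_map; apply: uniq_perm.
- by rewrite map_inj_uniq ?enum_uniq.
- exact: enum_uniq.
- move=> C; rewrite mem_enum; apply/mapP/imsetP => -[D].
    by rewrite mem_enum => DO ->; exists D.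
  by move=> DO ->; exists D; rewrite ?mem_enum.
Qed.

Lemma imset_perm_on B t : perm_on B t -> t @: B = B.
Proof.
move=> tB; apply/eqP; rewrite eqEcard card_imset ?leqnn ?andbT; last exact: perm_inj.
by apply/subsetP => _ /imsetP[x xB ->]; rewrite perm_closed.
Qed.

Lemma card_orbsJ B s t : perm_on B t -> #|orbs B (s ^ t)%g| = #|orbs B s|.
Proof.
move=> tB; rewrite -{1}(imset_perm_on tB) orbsJ card_imset //.
by apply: imset_inj; apply: perm_inj.
Qed.

Lemma card_orbsC B s t : perm_on B s -> #|orbs B (s * t)%g| = #|orbs B (t * s)%g|.
Proof. by move=> sB; rewrite -(card_orbsJ (s * t) sB) conjgE !mulgA mulVg mul1g. Qed.

Lemma perm_onD1 B e s : perm_on (B :\ e) s = perm_on B s && (s e == e).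
Proof.
apply/idP/andP => [sB|[sB /eqP se]].
  split; first by apply: subset_trans sB (subsetDl _ _).
  by rewrite (out_perm sB) // !inE eqxx.
apply/subsetP => z zs; rewrite !inE (subsetP sB) // andbT.
by move: zs; rewrite inE; apply: contraNneq => ->; rewrite se.
Qed.

Lemma perm_onJ B s t : perm_on B s -> perm_on B t -> perm_on B (s ^ t)%g.
Proof. by move=> sB tB; rewrite conjgE !perm_onM ?perm_onV. Qed.

Lemma delJ e s t : (del e s ^ t)%g = del (t e) (s ^ t)%g.
Proof. by rewrite /del conjMg tpermJ -conjVg permJ. Qed.

Lemma card_orbs_fix B e s : perm_on B s -> e \in B -> s e = e ->
  #|orbs B s| = (#|orbs (B :\ e) s|).+1.
Proof.
move=> sB eB se; rewrite orbs_fix // -(porbit_fix se).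
by rewrite (cardsD1 (porbit s e)) mem_orbs.
Qed.

Lemma card_orbs_tperm B e w s : perm_on B s -> e \in B -> w \in B -> w != e ->
  s e = e -> #|orbs B (tperm e w * s)%g| = #|orbs (B :\ e) s|.
Proof.
move=> sB eB wB we se; have Oe := porbit_fix se.
have wOe : w \notin porbit s e by rewrite Oe inE.
have wO : porbit s w \in orbs B s :\ porbit s e.
  by rewrite !inE mem_orbs // eq_porbit_mem wOe.
rewrite orbs_fix // -Oe (cardsD1 (porbit s w) (orbs B s :\ _)) wO.
rewrite (cardsD1 (porbit s e :|: porbit s w) (orbs B _)) orbs_tperm_rest //; congr (_ + _)%N.
by rewrite orbs_tperm // !inE eqxx.
Qed.

Lemma card_orbs_del B e s t : e \in B -> perm_on B s -> perm_on (B :\ e) t ->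
  #|orbs B (s * t)%g| = (#|orbs (B :\ e) (del e s * t)%g| + (s e == e))%N.
Proof.
move=> eB sB tB'; have := tB'; rewrite perm_onD1 => /andP[tB /eqP te].
have [se|se] := eqVneq (s e) e.
  by rewrite del_id // addn1 (@card_orbs_fix B e) ?perm_onM // permM se te.
have dB : perm_on B (del e s).
  by have := perm_on_del sB eB; rewrite perm_onD1 => /andP[].
have wB : s^-1%g e \in B by rewrite perm_closed // perm_onV.
have we : s^-1%g e != e by apply: contraNneq se => we; rewrite -{1}we permKV.
have de : (del e s * t)%g e = e by rewrite permM del_fix te.
by rewrite addn0 -{1}(delK e s) -mulgA card_orbs_tperm // perm_onM.
Qed.

Definition orbs_total B s t : rat :=
  \sum_(u | perm_on B u) #|orbs B (s ^ u * t)%g|%:R.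

(** If [u] sends [x] to [e], then [e] plays in [s ^ u] the role of [x] in [s].
    As [t] fixes [e], deleting it from the product deletes [x] from [s], and
    loses one cycle exactly when [x] is fixed. *)
Lemma orbs_total_fix B e x s t : e \in B -> x \in B ->
  perm_on B s -> perm_on (B :\ e) t ->
  \sum_(u | perm_on B u && (u x == e)) #|orbs B (s ^ u * t)%g|%:R =
  orbs_total (B :\ e) (del x s ^ tperm x e)%g t
  + (#|B|.-1)`!%:R * (s x == x)%:R :> rat.
Proof.
move=> eB xB sB tB; have ttB := perm_on_tperm xB eB.
rewrite (reindex_inj (mulgI (tperm x e))) /=.
rewrite (eq_bigl (perm_on (B :\ e))); last first.
  move=> u; rewrite perm_onD1 permM tpermL; congr (_ && _).
  apply/idP/idP => h; last exact: perm_onM.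
  by rewrite -(mul1g u) -(tperm2 x e) -mulgA perm_onM.
have -> : (#|B|.-1)`! = #|[pred u | perm_on (B :\ e) u]|.
  by rewrite card_perm (cardsD1 e B) eB.
rewrite -sum1_card natr_sum mulr_suml -big_split; apply: eq_bigr => u uB /=.
rewrite mul1r -natrD; congr _%:R; rewrite conjgM.
have ue : u e = e by apply/eqP; move: uB; rewrite perm_onD1 => /andP[].
have uB' : perm_on B u by move: uB; rewrite perm_onD1 => /andP[].
rewrite (card_orbs_del eB _ tB); last first.
  by rewrite !perm_onJ.
rewrite !delJ tpermL ue; congr (_ + nat_of_bool _)%N.
have -> : ((s ^ tperm x e) ^ u)%g e = u (tperm x e (s x)).
  by rewrite -[X in _ X = _]ue permJ -[X in u (_ X)](tpermL x e) permJ.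
have eE : e = u (tperm x e x) by rewrite tpermL ue.
by rewrite [X in _ == X]eE (inj_eq perm_inj) (inj_eq perm_inj).
Qed.

Lemma orbs_total_partition B e (F : {perm T} -> rat) : e \in B ->
  \sum_(u | perm_on B u) F u =
  \sum_(x in B) \sum_(u | perm_on B u && (u x == e)) F u.
Proof.
move=> eB; rewrite (partition_big (fun u => u^-1%g e) (mem B)) /=; last first.
  by move=> u uB; rewrite perm_closed // perm_onV.
apply: eq_bigr => x xB; apply: eq_bigl => u; congr (_ && _).
by apply/eqP/eqP => [<-|<-]; rewrite ?permKV ?permK.
Qed.

Lemma orbs_total_insert1 B e s t : e \in B -> perm_on B s -> perm_on (B :\ e) t ->
  orbs_total B s t = \sum_(x in B)
    (orbs_total (B :\ e) (del x s ^ tperm x e)%g t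
     + (#|B|.-1)`!%:R * (s x == x)%:R).
Proof.
move=> eB sB tB; rewrite /orbs_total (orbs_total_partition _ eB).
by apply: eq_bigr => x xB; rewrite (orbs_total_fix eB xB sB tB).
Qed.

(** The transposition that inserts [e] into [t] moves, by cyclic invariance of
    the number of cycles, next to [s ^ u]. There it is the conjugate under [u]
    of a transposition [(x y)] with [u x = e]. *)
Lemma orbs_total_insert B e s t : e \in B -> perm_on B s -> perm_on (B :\ e) t ->
  \sum_(w in B :\ e) orbs_total B s (tperm e w * t)%g =
  \sum_(x in B) \sum_(y in B :\ x)
    (orbs_total (B :\ e) (del x (tperm x y * s) ^ tperm x e)%g t
     + (#|B|.-1)`!%:R * ((tperm x y * s)%g x == x)%:R).
Proof.
move=> eB sB tB'; have := tB'; rewrite perm_onD1 => /andP[tB /eqP te].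
transitivity (\sum_(w in B :\ e) \sum_(u | perm_on B u)
    (#|orbs B (tperm e w * s ^ u * t)%g|%:R : rat)).
  rewrite [RHS](reindex_inj (@perm_inj _ t)) /=; apply: eq_big => [w|w].
    by rewrite perm_closed.
  rewrite !inE => /andP[we wB]; apply: eq_bigr => u uB.
  have suB : perm_on B (s ^ u)%g by exact: perm_onJ.
  have -> : (tperm e w * t = t * tperm e (t w))%g.
    by rewrite -{2}te -tpermJ conjgE !mulgA mulgV mul1g.
  by rewrite mulgA (card_orbsC _ (perm_onM suB tB)) mulgA.
rewrite exchange_big /= (orbs_total_partition _ eB); apply: eq_bigr => x xB.
transitivity (\sum_(u | perm_on B u && (u x == e)) \sum_(y in B :\ x)
    (#|orbs B ((tperm x y * s) ^ u * t)%g|%:R : rat)).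
  apply: eq_bigr => u /andP[uB /eqP ux].
  rewrite (reindex_inj (@perm_inj _ u)) /=; apply: eq_big => [y|y _].
    by rewrite !inE -{1}ux (inj_eq perm_inj) perm_closed.
  by rewrite conjMg tpermJ ux.
rewrite exchange_big /=; apply: eq_bigr => y; rewrite !inE => /andP[yx yB].
by rewrite (orbs_total_fix eB xB _ tB') // perm_onM // perm_on_tperm.
Qed.

Lemma orbs_totalJ B s t u : perm_on B u -> orbs_total B s (t ^ u)%g = orbs_total B s t.
Proof.
move=> uB; rewrite /orbs_total (reindex_inj (mulIg u)) /=.
apply: eq_big => [v|v vB]; last by rewrite conjgM -conjMg card_orbsJ.
apply/idP/idP => h; last exact: perm_onM.
by rewrite -(mulgK u v) perm_onM // perm_onV.
Qed.

End Averages.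

(** * The universal formula for the averaged cycle count *)

Lemma harmonicS n : harmonic_number n.+1 = harmonic_number n + n.+1%:R^-1.
Proof. by rewrite /harmonic_number big_nat_recr. Qed.

Section Universal.
Variable T : finType.
Implicit Types (x y z e w : T) (s t u v : {perm T}) (B : {set T}).

(** The insertion step yields linear relations between the failures of the
    formula for several permutations, rather than the formula itself. *)
Definition defect B s t : rat :=
  orbs_total B s t - (#|B|`!%:R * harmonic_number #|B|
     - pairing #|B| (chi (ctype B s)) (halfchi (ctype B t))).

Definition universal B t := forall s, perm_on B s -> defect B s t = 0.

Lemma tperm_setD1 B x e : x \in B -> e \in B -> tperm x e @: (B :\ x) = B :\ e.
Proof.
move=> xB eB; apply/setP => z; rewrite -{1}(tpermK x e z) (mem_imset _ _ perm_inj).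
rewrite !inE perm_closed ?perm_on_tperm //.
by rewrite -[X in _ != X](tpermR x e) (inj_eq perm_inj).
Qed.

Lemma universalE B t : universal B t -> forall s, perm_on B s ->
  orbs_total B s t = #|B|`!%:R * harmonic_number #|B|
     - pairing #|B| (chi (ctype B s)) (halfchi (ctype B t)).
Proof. by move=> U s sB; apply/eqP; rewrite -subr_eq0; apply/eqP; exact: U. Qed.

Lemma universal_del B e x s t : x \in B -> e \in B -> universal (B :\ e) t ->
  perm_on B s ->
  orbs_total (B :\ e) (del x s ^ tperm x e)%g t =
  (#|B|.-1)`!%:R * harmonic_number #|B|.-1
  - pairing #|B|.-1 (chi (ctype (B :\ x) (del x s))) (halfchi (ctype (B :\ e) t)).
Proof.
move=> xB eB U sB; have cB : #|B :\ e| = #|B|.-1 by rewrite (cardsD1 e B) eB.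
rewrite universalE // ?cB.
  congr (_ - _); apply: eq_pairing => // a b c; apply: perm_chi.
  by rewrite -(tperm_setD1 xB eB) ctypeJ.
rewrite delJ tpermL perm_on_del //.
by rewrite perm_onJ // perm_on_tperm.
Qed.

Lemma universal0 t : universal set0 t.
Proof.
move=> s _; rewrite /defect cards0 /harmonic_number big_geq // mulr0.
rewrite /pairing /sum3 big_ord0 !subr0 /orbs_total big1 // => u _.
by rewrite /orbs imset0 cards0.
Qed.

(** Adding a fixed point to [t] multiplies [halfchi] by [P_1], and on the side
    of [s] deletes a point in all possible ways. *)
Lemma universal_fix B e t : e \in B -> perm_on (B :\ e) t ->
  universal (B :\ e) t -> universal B t.
Proof.
move=> eB tB' U s sB; rewrite /defect (orbs_total_insert1 eB sB tB').
have /andP[tB /eqP te] : perm_on B t && (t e == e) by rewrite -perm_onD1.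
have [n Bn] : exists n, #|B| = n.+1 by exists #|B|.-1; rewrite (cardsD1 e B) eB.
rewrite (eq_bigr (fun x => n`!%:R * harmonic_number n
  - pairing n (chi (ctype (B :\ x) (del x s))) (halfchi (ctype (B :\ e) t))
  + n`!%:R * (s x == x)%:R)); last first.
  by move=> x xB; rewrite (universal_del xB eB U sB) Bn.
rewrite Bn /= big_split sumrB sumr_const -!mulr_sumr -pairing_suml /=.
rewrite (sum_fixed sB) -[_ *+ _]mulr_natl Bn.
rewrite (eq_pairing n (sum_del sB) (fun a b c => erefl)).
have -> : pairing n.+1 (chi (ctype B s)) (halfchi (ctype B t)) =
    pairing n.+1 (chi (ctype B s)) (halfchi (1%N :: ctype (B :\ e) t)).
  apply: eq_pairing => // a b c; apply: perm_pmuls.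
  rewrite /ctype orbs_fix // -(porbit_fix te).
  by rewrite (permPl (sizesD1 (mem_orbs t eB))) (porbit_fix te) cards1.
have sz : sumn (ctype (B :\ e) t) = n.
  by rewrite sumn_ctype // -[RHS]/(n.+1.-1) -Bn (cardsD1 e B) eB.
rewrite pairing_pmul1 //.
have := chi_hook1 (ctype_gt0 B s); rewrite sumn_ctype // Bn => /(_ isT).
have -> : n.+1%:Z - 1 = n by lia.
move=> ->; rewrite harmonicS factS natrM.
by field; rewrite addrC natr1 pnatr_eq0.
Qed.

Lemma ctype_insert B e w t : e \in B -> w \in B :\ e -> perm_on (B :\ e) t ->
  perm_eq (ctype B (tperm e w * t)%g)
    (#|porbit t w|.+1 :: sizes (orbs (B :\ e) t :\ porbit t w)).
Proof.
move=> eB wB'; have /setD1P[we wB] := wB'.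
move=> tB'; have /andP[tB /eqP te] : perm_on B t && (t e == e) by rewrite -perm_onD1.
have Oe := porbit_fix te.
have wOe : w \notin porbit t e by rewrite Oe inE.
rewrite /ctype orbs_fix // -Oe -orbs_tperm_rest //.
have -> : #|porbit t w|.+1 = #|porbit t e :|: porbit t w|.
  by rewrite Oe cardsU1 porbit_sym (negPf wOe).
by apply: sizesD1; rewrite -porbit_tperm // mem_orbs.
Qed.

(** Both sides of the formula for the insertions of [e] into [t] are expressed
    by data on [B :\ e]. The fixed points of the products [(x y) s] cancel
    against the boundary term of the adjunction, up to [n * n!]; this is what
    the increment [1 / (n + 1)] of the harmonic number contributes over the [n]
    insertions. *)
Lemma sum_defect_insert B e t : e \in B -> perm_on (B :\ e) t ->
  universal (B :\ e) t -> forall s, perm_on B s ->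
  \sum_(w in B :\ e) defect B s (tperm e w * t)%g = 0.
Proof.
move=> eB tB' U s sB; rewrite /defect sumrB (orbs_total_insert eB sB tB').
have [n Bn] : exists n, #|B| = n.+1 by exists #|B|.-1; rewrite (cardsD1 e B) eB.
have cB x : x \in B -> #|B :\ x| = n.
  by move=> xB; rewrite -[RHS]/(n.+1.-1) -Bn (cardsD1 x B) xB.
have sz : sumn (ctype (B :\ e) t) = n by rewrite sumn_ctype // cB.
have UD x y : x \in B -> y \in B :\ x ->
  orbs_total (B :\ e) (del x (tperm x y * s) ^ tperm x e)%g t =
  n`!%:R * harmonic_number n
  - pairing n (chi (ctype (B :\ x) (del x (tperm x y * s)%g))) (halfchi (ctype (B :\ e) t)).
  move=> xB /setD1P[_ yB]; rewrite universal_del // ?Bn //.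
  by rewrite perm_onM ?perm_on_tperm.
transitivity (\sum_(x in B) \sum_(y in B :\ x) (n`!%:R * harmonic_number n
  - pairing n (chi (ctype (B :\ x) (del x (tperm x y * s)%g))) (halfchi (ctype (B :\ e) t))
  + n`!%:R * (s y == x)%:R)
  - \sum_(w in B :\ e) (n.+1`!%:R * harmonic_number n.+1
      - pairing n.+1 (chi (ctype B s)) (halfchi (ctype B (tperm e w * t)%g)))).
  rewrite Bn; congr (_ - _); apply: eq_bigr => x xB; apply: eq_bigr => y yB.
  by rewrite UD // permM tpermL.
have S1 : \sum_(x in B) \sum_(y in B :\ x) (n`!%:R * harmonic_number n
  - pairing n (chi (ctype (B :\ x) (del x (tperm x y * s)%g))) (halfchi (ctype (B :\ e) t))
  + n`!%:R * (s y == x)%:R) = n.+1%:R * n%:R * n`!%:R * harmonic_number n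
  - pairing n (cutjoinOp (chi (ctype B s))) (halfchi (ctype (B :\ e) t))
  + n`!%:R * (n.+1%:R - (count_mem 1%N (ctype B s))%:R) :> rat.
  rewrite (eq_bigr (fun x => n%:R * (n`!%:R * harmonic_number n)
     - pairing n (fun a b c => \sum_(y in B :\ x)
        chi (ctype (B :\ x) (del x (tperm x y * s)%g)) a b c) (halfchi (ctype (B :\ e) t))
     + n`!%:R * (1 - (s x == x)%:R))); last first.
    move=> x xB; rewrite big_split sumrB sumr_const cB // -[X in X - _]mulr_natl /=.
    rewrite -pairing_suml -mulr_sumr; congr (_ + _ * _).
    (* Exactly one [y] makes [x] a fixed point of the product, namely [s^-1 x],
       and it is excluded from the sum when [s] fixes [x]. *)
    have sxB : s^-1%g x \in B by rewrite perm_closed // perm_onV.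
    have e1 : \sum_(y in B) (s y == x)%:R
      = (s x == x)%:R + \sum_(y in B :\ x) (s y == x)%:R :> rat := big_setD1 x xB.
    suff e2 : \sum_(y in B) (s y == x)%:R = 1 :> rat.
      by apply: (@addrI _ (s x == x)%:R); rewrite -e1 e2 [RHS]addrC subrK.
    rewrite (bigD1 (s^-1%g x)) //= permKV eqxx big1 ?addr0 // => y /andP[_].
    by rewrite -(inj_eq (@perm_inj _ s)) permKV => /negPf ->.
  rewrite big_split sumrB sumr_const Bn -[X in X - _]mulr_natl /= mulrA -!mulr_sumr.
  rewrite -pairing_suml (eq_pairing n (sum_del_tperm sB) (fun a b c => erefl)).
  rewrite sumrB sumr_const Bn (sum_fixed sB) -!mulrA; congr (_ + _ * (_ - _)).
rewrite S1 sumrB sumr_const cB // -[X in _ - (X - _)]mulr_natl -pairing_sumr.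
have -> : pairing n.+1 (chi (ctype B s)) (fun a b c =>
    \sum_(w in B :\ e) halfchi (ctype B (tperm e w * t)%g) a b c)
  = pairing n.+1 (chi (ctype B s)) (insertOp (halfchi (ctype (B :\ e) t))).
  (* The first summand comes from the value of [L] on the kernel; it is
     symmetric in [x] and [z]. *)
  transitivity (pairing n.+1 (chi (ctype B s)) (pmuls (ctype (B :\ e) t) one_series)
      + pairing n.+1 (chi (ctype B s)) (fun a b c =>
          \sum_(w in B :\ e) halfchi (ctype B (tperm e w * t)%g) a b c)).
    rewrite [X in X + _]pairing_chi_sym ?add0r ?sumn_ctype //.
    exact: pmuls_one_series_sym.
  rewrite -pairing_addr; apply: eq_pairing => // a b c.
  rewrite insertOp_pmuls; congr (_ + _); first last.
    set r := ctype (B :\ e) t.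
    rewrite -(sum_sizes (orbs (B :\ e) t) (fun k => pmul (k%:Z + 1) (halfchi (rem k r)) a b c)).
    rewrite -(sum_orbs (fun C : {set T} => pmul (#|C|%:Z + 1) (halfchi (rem #|C| r)) a b c) tB') //.
    apply: eq_big => [w|w wB']; first by case: (boolP (w \in B :\ e)) => //= ?; rewrite mem_orbs.
    rewrite /halfchi (perm_pmuls _ (ctype_insert eB wB' tB')) /= -addn1 PoszD.
    apply: eq_pmul; apply: perm_pmuls; apply: sizes_rem; exact: mem_orbs.
  rewrite /pmuls; elim: (ctype _ _) a b c => [|k r IH] a b c /=; first by rewrite insertOp_inv_yz.
  exact: eq_pmul.
rewrite pairing_insertOp //.
have := chi_hook1 (ctype_gt0 B s); rewrite sumn_ctype // Bn => /(_ isT).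
have -> : n.+1%:Z - 1 = n by lia.
move=> ->; rewrite harmonicS factS natrM.
by field; rewrite addrC natr1 pnatr_eq0.
Qed.

Lemma defectJ B s t u : perm_on B u -> defect B s (t ^ u)%g = defect B s t.
Proof.
move=> uB; rewrite /defect orbs_totalJ //; congr (_ - (_ - _)).
apply: eq_pairing => // a b c; apply: perm_pmuls.
by rewrite -{1}(imset_perm_on uB) ctypeJ.
Qed.

(** The insertions of [e] at two places of one cycle of [t] are conjugate under
    a power of [t], so they have the same defect, which therefore vanishes if
    all the other insertions have defect zero. *)
Lemma universal_insert B e w t : e \in B -> w \in B :\ e -> perm_on (B :\ e) t ->
  universal (B :\ e) t ->
  (forall x, x \in B :\ e -> x \notin porbit t w -> universal B (tperm e x * t)%g) ->
  universal B (tperm e w * t)%g.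
Proof.
move=> eB wB' tB' U V s sB; have := sum_defect_insert eB tB' U sB.
have /andP[tB /eqP te] : perm_on B t && (t e == e) by rewrite -perm_onD1.
rewrite (bigID (mem (porbit t w))) /= [X in _ + X]big1 ?addr0; last first.
  by move=> v /andP[vB vw]; apply: V.
rewrite (eq_bigr (fun=> defect B s (tperm e w * t)%g)).
  rewrite sumr_const -mulr_natl => /eqP; rewrite mulf_eq0 => /orP[|/eqP //].
  rewrite pnatr_eq0 => /eqP /card0_eq /(_ w).
  by rewrite [LHS]unfold_in wB' /= porbit_id.
move=> v /andP[vB' /porbitP[i ->]].
have -> : (tperm e ((t ^+ i)%g w) * t = (tperm e w * t) ^ (t ^+ i))%g.
  rewrite conjMg tpermJ [(t ^ (t ^+ i))%g]conjgE (commuteX i (commute_refl t)) mulKg.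
  congr (tperm _ _ * _)%g; rewrite permX.
  by elim: i => //= i <-.
by rewrite defectJ //; elim: i => [|i IH]; rewrite ?expg0 ?perm_on1 // expgS perm_onM.
Qed.

End Universal.

(** * Permutations with one or two cycles *)

Section CycleTypes.
Variable T : finType.
Implicit Types (x y z e w : T) (s t u v : {perm T}) (B : {set T}).

Lemma ctype_pick B t q (r : seq nat) : perm_eq (ctype B t) (q :: r) ->
  exists2 e, e \in B & #|porbit t e| = q /\ perm_eq (sizes (orbs B t :\ porbit t e)) r.
Proof.
move=> ctr; have : q \in ctype B t by rewrite (perm_mem ctr) mem_head.
case/mapP=> C; rewrite mem_enum => CO qC; have /imsetP[e eB Ce] := CO.
exists e => //; rewrite -Ce; split=> //.
rewrite -(perm_cons #|C|) -{2}qC; apply: perm_trans ctr.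
by rewrite perm_sym; exact: sizesD1.
Qed.

Lemma ctype_del_insert B e t : e \in B -> perm_on B t -> t e != e ->
  exists w, exists t',
  [/\ perm_on (B :\ e) t', w \in B :\ e, t = (tperm e w * t')%g,
      #|porbit t e| = #|porbit t' w|.+1
    & orbs B t :\ porbit t e = orbs (B :\ e) t' :\ porbit t' w].
Proof.
move=> eB tB te; set w := (t^-1 e)%g; set d := del e t.
have we : w != e by apply: contraNneq te => we; rewrite -{1}we permKV.
have wB : w \in B by rewrite perm_closed // perm_onV.
have dB : perm_on (B :\ e) d by exact: perm_on_del.
have [dB0 /eqP de] : perm_on B d /\ d e == e by apply/andP; rewrite -perm_onD1.
have Oe := porbit_fix de.
have wOe : w \notin porbit d e by rewrite Oe inE.
have tE : t = (tperm e w * d)%g by rewrite delK.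
have Ot : porbit t e = porbit d e :|: porbit d w by rewrite {1}tE porbit_tperm.
exists w, d; split => //.
- by rewrite !inE we.
- by rewrite Ot Oe cardsU1 porbit_sym (negPf wOe).
- by rewrite Ot {1}tE orbs_tperm_rest // orbs_fix // Oe.
Qed.

Lemma ctype_insert_type B e w t q (r : seq nat) : e \in B -> w \in B :\ e ->
  perm_on (B :\ e) t -> #|porbit t w| = q ->
  perm_eq (ctype (B :\ e) t) (q :: r) -> perm_eq (ctype B (tperm e w * t)%g) (q.+1 :: r).
Proof.
move=> eB wB tB wq ctr; rewrite (permPl (ctype_insert eB wB tB)) wq perm_cons.
rewrite -(perm_cons q); apply: perm_trans ctr.
by rewrite perm_sym -{1}wq; apply: sizesD1; apply: mem_orbs.
Qed.

(** By this the set of maps is not empty, so that the expectation is a genuine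
    mean. *)
Lemma exists_ctype B (r : seq nat) : all (leq 1) r -> sumn r = #|B| ->
  exists2 t, perm_on B t & perm_eq (ctype B t) r.
Proof.
move: {2}#|B| (erefl #|B|) => n; elim: n B r => [|n IH] B r nB.
  case: r => [|[|k] r] //= _; last by rewrite nB.
  move=> _; exists 1%g; first exact: perm_on1.
  move/eqP: nB; rewrite cards_eq0 => /eqP ->.
  by rewrite /ctype /orbs imset0 /sizes enum_set0.
have [e eB] : exists e, e \in B by apply/set0Pn; rewrite -cards_eq0 nB.
have nB' : #|B :\ e| = n by move: (cardsD1 e B); rewrite eB nB add1n => -[].
case: r => [|[|[|k]] r] //=; first by rewrite nB.
  move=> r0 sr; have [|t tB' ct] := IH (B :\ e) r nB' r0.
    by move: sr; rewrite nB nB' add1n => -[].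
  have /andP[tB /eqP te] : perm_on B t && (t e == e) by rewrite -perm_onD1.
  exists t => //; rewrite /ctype in ct *; rewrite orbs_fix // -(porbit_fix te) in ct.
  rewrite (permPl (sizesD1 (mem_orbs t eB))) (porbit_fix te) cards1 perm_cons.
  by rewrite -(porbit_fix te).
move=> r0 sr; have [//||t tB ct] := IH (B :\ e) (k.+1 :: r) nB'.
  by move: sr; rewrite nB nB' /= addSn => -[].
have [w wB [wk _]] := ctype_pick ct.
have /andP[tB' /eqP te] : perm_on B t && (t e == e) by rewrite -perm_onD1.
exists (tperm e w * t)%g; last exact: ctype_insert_type ct.
by move: wB => /setD1P[_ wB]; rewrite perm_onM // perm_on_tperm.
Qed.

Lemma universal_one q B t : perm_on B t -> perm_eq (ctype B t) [:: q] -> universal B t.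
Proof.
elim: q B t => [|q IH] B t tB ct.
  have := ctype_gt0 B t; rewrite (perm_all _ ct) //.
have [e eB [eq er]] := ctype_pick ct.
have [te|te] := eqVneq (t e) e.
  have tB' : perm_on (B :\ e) t by rewrite perm_onD1 tB te eqxx.
  apply: (universal_fix eB tB'); have : #|B :\ e| = 0%N.
    by rewrite -(sumn_ctype tB') /ctype orbs_fix // -(porbit_fix te) (perm_sumn er).
  by move/eqP; rewrite cards_eq0 => /eqP ->; exact: universal0.
have [w [d [dB wB tE wd Ed]]] := ctype_del_insert eB tB te.
have cw : #|porbit d w| = q by apply: succn_inj; rewrite -wd eq.
have cd : perm_eq (ctype (B :\ e) d) [:: q].
  by rewrite (permPl (sizesD1 (mem_orbs d wB))) cw perm_cons -Ed.
rewrite tE; apply: (universal_insert eB wB dB (IH _ _ dB cd)) => x xB xw.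
have : porbit d x \in orbs (B :\ e) d :\ porbit d w.
  by rewrite !inE mem_orbs // eq_porbit_mem xw.
move: er; rewrite Ed => /perm_size /=; rewrite size_map -cardE => /eqP.
by rewrite cards_eq0 => /eqP ->; rewrite inE.
Qed.

(** A permutation of type [p + 1, q] is an insertion into one of type [p, q].
    The insertions into the other cycle have type [p, q + 1], which has a
    smaller first part. *)
Lemma universal_two p q B t : (0 < p)%N -> (0 < q)%N -> perm_on B t ->
  perm_eq (ctype B t) [:: p; q] -> universal B t.
Proof.
elim: p q B t => // p IH q B t _ q0 tB ct.
have [e eB [eq er]] := ctype_pick ct.
have [te|te] := eqVneq (t e) e.
  have tB' : perm_on (B :\ e) t by rewrite perm_onD1 tB te eqxx.
  apply: (universal_fix eB tB'); apply: (universal_one tB' (q := q)).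
  by rewrite /ctype orbs_fix // -(porbit_fix te).
have [w [d [dB wB tE wd Ed]]] := ctype_del_insert eB tB te.
have cw : #|porbit d w| = p by apply: succn_inj; rewrite -wd eq.
have p0 : (0 < p)%N by rewrite -cw lt0n card_porbit_neq0.
have cd : perm_eq (ctype (B :\ e) d) [:: p; q].
  by rewrite (permPl (sizesD1 (mem_orbs d wB))) cw perm_cons -Ed.
rewrite tE; apply: (universal_insert eB wB dB (IH _ _ _ p0 q0 dB cd)) => x xB xw.
have Ox : porbit d x \in orbs (B :\ e) d :\ porbit d w.
  by rewrite !inE mem_orbs // eq_porbit_mem xw.
have cx : #|porbit d x| = q.
  rewrite -Ed in Ox; have : #|porbit d x| \in sizes (orbs B t :\ porbit t e).
    by apply: map_f; rewrite mem_enum.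
  by rewrite (perm_mem er) inE => /eqP.
have xBt : perm_on B (tperm e x * d)%g.
  have /andP[dB' _] : perm_on B d && (d e == e) by rewrite -perm_onD1.
  by move: xB => /setD1P[_ xB]; rewrite perm_onM // perm_on_tperm.
apply: (IH q.+1) => //.
rewrite -(permPr (permEl (perm_catC [:: q.+1] [:: p]))).
apply: (ctype_insert_type eB xB dB cx).
by rewrite (permPl cd); exact: (permEl (perm_catC [:: p] [:: q])).
Qed.

End CycleTypes.

(** * Evaluation of the pairing for two cycles and long parts *)

Arguments chi : simpl never.

Section Evaluation.
Implicit Types (f g : laurent) (a b c : int) (s t r : seq nat) (i j k n p q d : nat).

Lemma chi_cons k s a b c : chi (k :: s) a b c =
  chi s (a - k%:Z) b c - chi s a (b - k%:Z) c + chi s a b (c - k%:Z).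
Proof. by []. Qed.

(** The coefficients are signed counts of the sub-collections of [s] with a
    given sum. *)
Definition subset_poly s : {poly rat} := \prod_(k <- s) ('X^k - 1).

(** Subtracting the indicator of [c = sumn s] amounts to passing from
    nonnegative powers of [x] in the expansion of [1 / (y - x)] to negative
    ones. With nonnegative powers, a factor [x^k] cannot contribute to an
    exponent of [x] below all the parts, so only [z^k - y^k] matters; by
    homogeneity the exponent of [z] determines that of [y]. *)
Lemma chi_small_x p s b (c : nat) : (0 < p)%N -> all (ltn p) s -> top_degree s p b c ->
  chi s p b c = (subset_poly s)`_c - (c == sumn s)%:R.
Proof.
move=> p0; rewrite /top_degree; elim: s b c => [|k s IH] b c /=.
  move=> _ h; rewrite /subset_poly big_nil coef1 /chi /= /vander /inv_yz /inv_xy.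
  have -> : (p%:Z == 0) = false by lia.
  have -> : [&& c%:Z == 0, 0 <= b & p%:Z == - b - 1] = false by lia.
  by rewrite /=; ring.
case/andP=> pk ps h; rewrite chi_cons {1}/subset_poly big_cons -/(subset_poly s).
rewrite mulrBl mul1r coefB coefXnM.
rewrite chi_neg_x /top_degree; try lia.
rewrite IH //; last by lia.
case: ltnP => ck.
  rewrite chi_neg_z; last by lia.
  have -> : (c == k + sumn s)%N = false by lia.
  by rewrite eqz_nat opprB addr0 addKr sub0r subr0.
rewrite subzn // IH //; last by lia.
have -> : (c - k == sumn s)%N = (c == k + sumn s)%N by lia.
by rewrite eqz_nat opprB addKr addrA [- _ + _]addrC.
Qed.

(** In the expansion by nonnegative powers of [x], neither [x^k] nor [z^k] fits
    here, and only [- y^k] remains of each factor. *)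
Lemma chi_x0_low p s b (c : nat) : (c <= p)%N -> all (ltn p) s -> top_degree s 0 b c ->
  chi s 0 b c = (-1) ^+ size s * ((c == 0%N)%:R - 1) - (c == sumn s)%:R.
Proof.
move=> cp; rewrite /top_degree; elim: s b => [|k s IH] b /=.
  move=> _ h; rewrite /chi /= /vander /inv_yz /inv_xy expr0 mul1r.
  have -> : [&& 0 == 0 :> int, 0 <= c%:Z & b == - c%:Z - 1] by lia.
  have -> : [&& c%:Z == 0, 0 <= b & 0 == - b - 1] = false by lia.
  by rewrite addrAC subrr add0r /= subr0.
case/andP=> pk ps h; rewrite chi_cons chi_neg_x /top_degree; try lia.
rewrite IH //; last by lia.
rewrite chi_neg_z; last by lia.
have -> : (c == k + sumn s)%N = false by lia.
rewrite eqz_nat exprS; set u := (c == 0%N)%:R; set e := (c == sumn s)%:R.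
by rewrite /=; ring.
Qed.

(** Here every proper sub-collection of the factors [z^k] leaves a positive
    exponent of [z], where the kernel is constant, so only a sum of signs
    remains. *)
Lemma chi_x0_high p s b c : (sumn s)%:Z - p%:Z <= c -> all (ltn p) s -> top_degree s 0 b c ->
  chi s 0 b c = (c < (sumn s)%:Z)%R%:R - (s == [::])%:R.
Proof.
rewrite /top_degree; elim: s b c => [|k s IH] b c /=.
  move=> _ _ h; rewrite /chi /= /vander /inv_yz /inv_xy.
  have -> : [&& c == 0, 0 <= b & 0 == - b - 1] = false by lia.
  rewrite !(pmulrn 1) -?(intrN, intrB); apply: eq_intr; lia.
move=> cn /andP[pk ps] h; rewrite chi_cons chi_neg_x /top_degree; try lia.
rewrite !IH //; try lia.
have -> : (c == sumn s) = false by lia.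
have -> : (c < (sumn s)%:Z) = false by lia.
have -> : (c - k%:Z < (sumn s)%:Z) = (c < (k + sumn s)%N%:Z) by lia.
set u := (s == [::])%:R; set v := (c < _)%R%:R.
by rewrite /=; ring.
Qed.

(** Here all factors must contribute [x^k]. *)
Lemma chi_large_x_low p s a b (c : nat) : (c <= p)%N -> all (ltn p) s ->
  (sumn s)%:Z - p%:Z <= a < (sumn s)%:Z -> top_degree s a b c ->
  chi s a b c = - (c == 0%N)%:R.
Proof.
move=> cp; rewrite /top_degree; elim: s a b => [|k s IH] a b /=.
  move=> _ a0 h; rewrite chi_neg_x ?eqz_nat //; lia.
case/andP=> pk ps an h; rewrite chi_cons.
rewrite [chi s a _ _]chi_large_x /top_degree; try lia.
rewrite [chi s a _ _]chi_neg_z; last by lia.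
by rewrite IH //; try lia; ring.
Qed.

Lemma halfchi_two p q i j k : (0 < p)%N -> (p < q)%N -> (i + j + k).+1 = (p + q)%N ->
  halfchi [:: p; q] i j k =
  (i == 0%N)%:R * ((k < p)%N%:R - (q <= k)%N%:R) - (i == p)%:R - (i == q)%:R.
Proof.
move=> p0 pq e; rewrite /halfchi /= /pmul /inv_yz.
have [i0|i0] := eqVneq i 0%N; have [ip|ip] := eqVneq i p; have [iq|iq] := eqVneq i q;
have [kp|kp] := ltnP k p; have [kq|kq] := leqP q k; try lia;
by do !decide_indicator; rewrite /=; ring.
Qed.

Lemma sum3_pick n m (F : nat -> nat -> nat -> rat) : (m < n)%N ->
  sum3 n (fun i j k => (i == m)%:R * F i j k)
  = \sum_(k < n - m) F m (n - m - k).-1 k.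
Proof.
move=> mn; rewrite /sum3 (bigD1 (Ordinal mn)) //= [X in _ + X]big1 ?addr0; last first.
  move=> i /eqP im; apply: big1 => j _.
  by case: eqP => [e|_]; [case: im; apply: val_inj | rewrite mul0r].
rewrite (reindex_inj rev_ord_inj) /=; apply: eq_bigr => k _.
by rewrite eqxx mul1r; have := ltn_ord k => kn; congr (F _ _ _); lia.
Qed.

Definition alt_fact (n k : nat) : rat := (-1) ^+ (n - k).-1 * ((n - k).-1`! * k`!)%:R.

Lemma pairing_two p q s : (0 < p)%N -> (p < q)%N -> sumn s = (p + q)%N ->
  all (ltn p) s ->
  pairing (p + q) (chi s) (halfchi [:: p; q]) =
  - (-1) ^+ size s * \sum_(1 <= k < p) alt_fact (p + q) k
  - \sum_(q <= k < p + q) alt_fact (p + q) k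
  - p`!%:R * \sum_(k < q) alt_fact q k * (subset_poly s)`_k
  - (-1) ^+ p * (q`! * p.-1`!)%:R.
Proof.
move=> p0 pq sn sp; rewrite /pairing.
pose W i j k : rat := (-1) ^+ j * (i`! * j`! * k`!)%:R * chi s i j k.
rewrite (@eq_sum3 _ _ (fun i j k => (i == 0%N)%:R * (W i j k * ((k < p)%N%:R - (q <= k)%N%:R))
   + (-1 * ((i == p)%:R * W i j k) + -1 * ((i == q)%:R * W i j k)))); last first.
  by move=> i j k e; rewrite halfchi_two // -/(W i j k); ring.
rewrite !sum3_add !sum3_scale sum3_pick; last by lia.
rewrite sum3_pick; last by lia.
rewrite sum3_pick; last by lia.
rewrite subn0 addKn addnK.
have sN : s != [::] by apply/eqP => s0; move: sn; rewrite s0 /=; lia.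
have -> : \sum_(k < q) W p (q - k).-1 k = p`!%:R *
   \sum_(k < q) alt_fact q k * (subset_poly s)`_k.
  rewrite mulr_sumr; apply: eq_bigr => k _; have kq := ltn_ord k.
  rewrite /W (@chi_small_x p) // /top_degree ?sn; last by lia.
  have -> : (k == p + q :> nat)%N = false by lia.
  rewrite [X in _ * X = _]subr0 /alt_fact !natrM.
  by ring.
have -> : \sum_(k < p) W q (p - k).-1 k = (-1) ^+ p * (q`! * p.-1`!)%:R.
  case: p p0 pq sn sp => // p _ pq sn sp.
  rewrite big_ord_recl big1 /=; last first.
    move=> k _; have kp := ltn_ord k.
    rewrite /W (@chi_large_x_low p.+1) /bump ?sn /top_degree ?sn //; try lia.
    by rewrite /= oppr0 mulr0.
  rewrite /W (@chi_large_x_low p.+1) // /top_degree ?sn; try lia.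
  by rewrite eqxx fact0 muln1 /= exprS; ring.
have -> : \sum_(k < p + q) W 0%N (p + q - k).-1 k * ((k < p)%N%:R - (q <= k)%N%:R) =
   - (-1) ^+ size s * (\sum_(1 <= k < p) alt_fact (p + q) k)
  - \sum_(q <= k < p + q) alt_fact (p + q) k.
  rewrite -(big_mkord xpredT (fun k => W 0%N (p + q - k).-1 k * ((k < p)%N%:R - (q <= k)%N%:R))).
  rewrite (big_cat_nat (n := q)) ?leq_addl //= (big_cat_nat (n := p)) ?(ltnW pq) //=.
  rewrite [X in _ + X + _]big_nat_cond [X in _ + X + _]big1 ?addr0; last first.
    move=> k /andP[/andP[pk kq] _].
    have -> : (k < p)%N = false by lia.
    have -> : (q <= k)%N = false by lia.
    by rewrite subrr mulr0.
  congr (_ + _).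
    rewrite big_ltn // mulr_sumr.
    rewrite /W (@chi_x0_low p) // /top_degree ?sn; try lia.
    have -> : (0 == p + q)%N = false by lia.
    rewrite eqxx subrr mulr0 subr0 mulr0 mul0r add0r.
    apply: eq_big_nat => k /andP[k1 kp].
    rewrite (@chi_x0_low p) // /top_degree ?sn; try lia.
    have -> : (k == p + q)%N = false by lia.
    have -> : (k == 0)%N = false by lia.
    have -> : (q <= k)%N = false by lia.
    by rewrite kp /alt_fact fact0 mul1n /=; ring.
  rewrite -sumrN; apply: eq_big_nat => k /andP[qk kn].
  rewrite /W (@chi_x0_high p) // /top_degree ?sn; try lia.
  have -> : (k%:Z < (p + q)%N%:Z)%R by lia.
  have -> : (k < p)%N = false by lia.
  by rewrite qk (negPf sN) /alt_fact fact0 mul1n /=; ring.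
by ring.
Qed.

(** The sum telescopes, because
    [(n + 1) k! (n - 1 - k)! = k! (n - k)! + (k + 1)! (n - 1 - k)!]. *)
Lemma alt_fact_sum n (a b : nat) : (a <= b <= n)%N ->
  n.+1%:R * \sum_(a <= k < b) alt_fact n k
  = (-1) ^+ (n - b) * (b`! * (n - b)`!)%:R - (-1) ^+ (n - a) * (a`! * (n - a)`!)%:R.
Proof.
case/andP=> ab bn; rewrite mulr_sumr.
rewrite -(telescope_sumr (fun k => (-1) ^+ (n - k) * (k`! * (n - k)`!)%:R : rat) ab).
apply: eq_big_nat => k /andP[ak kb].
have [u nu] : exists u, n = (k + u.+1)%N by exists (n - k).-1; lia.
rewrite nu addKn subnS addKn /alt_fact addKn /= !factS exprS !natrM.
have -> : (k + u.+1).+1%:R = k.+1%:R + u.+1%:R :> rat by rewrite -natrD; congr _%:R; lia.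
by ring.
Qed.

End Evaluation.

Lemma subset_poly_tuple d (mu : d.-tuple nat) k :
  (subset_poly mu)`_k = \sum_(S : {set 'I_d})
     (-1) ^+ (d - #|S|) * (k == \sum_(i in S) tnth mu i)%N%:R.
Proof.
rewrite /subset_poly big_tuple bigA_distr coef_sum; apply: eq_bigr => S _.
rewrite (bigID (mem S)) /= (eq_bigr (fun i => 'X^(tnth mu i))); last by move=> i ->.
rewrite [X in _ * X](eq_bigr (fun=> -1)); last by move=> i /negPf ->.
rewrite prodr_const prodrXr.
have -> : #|[predC (mem S)]| = (d - #|S|)%N.
  have Sd : (#|S| <= d)%N by rewrite -[X in (_ <= X)%N]card_ord max_card.
  apply: (@addnI #|S|); rewrite subnKC //.
  exact: etrans (cardC (mem S)) (card_ord d).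
have -> : (-1) ^+ (d - #|S|) = ((-1) ^+ (d - #|S|))%:P :> {poly rat}.
  by rewrite rmorphXn /= rmorphN1.
by rewrite mulrC coefCM coefXn.
Qed.

(** A missing part takes away more than [p], so the proper sub-collections are
    exactly those seen by the sum over [k < q]. *)
Lemma proper_parts_lt p q d (mu : d.-tuple nat) (S : {set 'I_d}) :
  sumn mu = (p + q)%N -> (forall i, (p < tnth mu i)%N) -> S \proper [set: 'I_d] ->
  (\sum_(i in S) tnth mu i < q)%N.
Proof.
move=> sm mp; rewrite properT => SnT; have [i iS] : exists i, i \in ~: S.
  by apply/set0Pn; apply: contraNneq SnT => e; rewrite -(setCK S) e setC0.
have tot : (\sum_(i in S) tnth mu i + \sum_(i in ~: S) tnth mu i = p + q)%N.
  rewrite -sm sumnE big_tuple [RHS](bigID (mem S)) /=; congr (_ + _)%N.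
  by apply: eq_bigl => j; rewrite inE.
have : (p < \sum_(i in ~: S) tnth mu i)%N by rewrite (bigD1 i) //= ltn_addr.
by move: tot; clear; lia.
Qed.

Lemma sum_subset_poly p q d (mu : d.-tuple nat) (h : nat -> rat) :
  sumn mu = (p + q)%N -> (forall i, (p < tnth mu i)%N) ->
  \sum_(k < q) h k * (subset_poly mu)`_k =
  \sum_(S : {set 'I_d} | S \proper [set: 'I_d])
    (-1) ^+ (d - #|S|) * h (\sum_(i in S) tnth mu i)%N.
Proof.
move=> sm mp; pose Sg (S : {set 'I_d}) := (\sum_(i in S) tnth mu i)%N.
rewrite (eq_bigr (fun k : 'I_q => \sum_(S : {set 'I_d})
   (-1) ^+ (d - #|S|) * (h k * (k == Sg S :> nat)%:R))); last first.
  move=> k _; rewrite subset_poly_tuple mulr_sumr; apply: eq_bigr => S _; ring.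
rewrite exchange_big /= [RHS]big_mkcond; apply: eq_bigr => S _.
rewrite -mulr_sumr; case: ifP => SS.
  have ltq : (Sg S < q)%N by exact: proper_parts_lt sm mp SS.
  rewrite (bigD1 (Ordinal ltq)) //= eqxx big1 ?addr0 ?mulr1 //.
  move=> k /eqP kS; case: eqP => [e|_]; last by rewrite mulr0.
  by case: kS; apply: val_inj.
rewrite big1 ?mulr0 // => k _; case: eqP => [e|_]; last by rewrite mulr0.
move: SS; rewrite properT => /negbFE/eqP SS; move: (ltn_ord k).
rewrite e SS /Sg (eq_bigl xpredT); last by move=> i; rewrite inE.
by rewrite -(big_tuple _ _ _ xpredT id) -sumnE sm; clear; lia.
Qed.

(** * Connectedness and the expected genus *)

(** Otherwise [K] and its complement would each contain one cycle of [t]. One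
    of them would then be the cycle of length [p], which is too short to
    contain a cycle of [s]. *)
Lemma no_stable_set (T : finType) p q (s t : {perm T}) (K : {set T}) x y :
  perm_eq (ctype [set: T] t) [:: p; q] ->
  (forall z, p < #|porbit s z|)%N ->
  (forall z, z \in K -> s z \in K) -> (forall z, z \in K -> t z \in K) ->
  x \in K -> y \notin K -> False.
Proof.
move=> ct sp sK tK xK yK.
have stab (u : {perm T}) z : (forall z, z \in K -> u z \in K) -> z \in K ->
    porbit u z \subset K.
  move=> uK zK; apply/subsetP => v /porbitP[i ->]; rewrite permX.
  by elim: i => //= i; apply: uK.
have O z : porbit t z \in orbs setT t by rewrite mem_orbs ?inE.
have xy : porbit t y != porbit t x.
  apply: contraNneq yK => xy; apply: (subsetP (stab t x tK xK)).
  by rewrite -xy porbit_id.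
have yO : porbit t y \in orbs setT t :\ porbit t x by rewrite !inE xy O.
have cE : perm_eq [:: p; q] [:: #|porbit t x|, #|porbit t y| &
    sizes (orbs setT t :\ porbit t x :\ porbit t y)].
  rewrite -(permPl ct) (permPl (sizesD1 (O x))) perm_cons; exact: sizesD1.
have only z : z \in porbit t x :|: porbit t y.
  apply/negPn/negP => zn.
  have : porbit t z \in orbs setT t :\ porbit t x :\ porbit t y.
    by move: zn; rewrite !inE negb_or O andbT !eq_porbit_mem andbC.
  have := perm_size cE; rewrite /= size_map -cardE => -[] /esym/eqP.
  by rewrite cards_eq0 => /eqP ->; rewrite inE.
have xp : (#|porbit t x| == p) || (#|porbit t y| == p).
  have : p \in [:: p; q] by rewrite mem_head.
  rewrite (perm_mem cE) !inE !(eq_sym p) => /or3P[->|->|] //; first by rewrite orbT.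
  have := perm_size cE; rewrite /=.
  by case: (sizes _) => // ? ? [].
have big (u : T) (L : {set T}) : porbit s u \subset L -> #|L| = p -> False.
  by move=> /subset_leq_card uL Lp; have := sp u; rewrite ltnNge -Lp uL.
case/orP: xp => /eqP xp.
  apply: (big x (porbit t x)) => //; apply: subset_trans (stab s x sK xK) _.
  apply/subsetP => z zK; have := only z; rewrite inE => /orP[//|zy].
  case/negP: yK; apply: (subsetP (stab t z tK zK)).
  by move: zy; rewrite porbit_sym.
apply: (big y (porbit t y)) => //; apply/subsetP => z zy.
have zK : z \notin K.
  apply: contra yK => zK; apply: (subsetP (stab s z sK zK)).
  by rewrite porbit_sym.
have := only z; rewrite inE => /orP[zx|//].
by case/negP: zK; apply: (subsetP (stab t x tK xK)).
Qed.

Lemma map_transitive n p q (s t : 'S_n) : (0 < n)%N ->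
  perm_eq (ctype setT t) [:: p; q] -> (forall z, p < #|porbit s z|)%N ->
  [transitive <<[set s; t]>>%g, on [set: 'I_n] | 'P].
Proof.
move=> n0 ct sp; pose x := Ordinal n0; apply/imsetP; exists x => //.
apply/esym/setP => y; rewrite inE; apply/negPn/negP => yO.
have st (u : 'S_n) : u \in [set s; t] -> forall z, z \in orbit 'P <<[set s; t]>>%g x ->
    u z \in orbit 'P <<[set s; t]>>%g x.
  move=> us z /orbitP[g gG <-]; apply/orbitP; exists (g * u)%g.
    by rewrite groupM // mem_gen.
  by rewrite /= /aperm permM.
apply: (no_stable_set ct sp (st s _) (st t _) (orbit_refl _ _ _) yO).
  by rewrite !inE eqxx.
by rewrite !inE eqxx orbT.
Qed.

Lemma orbs_setT (T : finType) (s : {perm T}) : orbs setT s = porbits s.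
Proof. by apply/setP => C; apply/imsetP/imsetP => -[x _ ->]; exists x. Qed.

Lemma has_cycle_typeE n (s : 'S_n) mu : has_cycle_type s mu = perm_eq (ctype setT s) mu.
Proof. by rewrite /has_cycle_type /ctype orbs_setT. Qed.

Lemma kappaE n (s : 'S_n) mu : perm_eq (ctype setT s) mu -> kappa s = size mu.
Proof. by move/perm_size <-; rewrite /ctype /sizes size_map -cardE orbs_setT. Qed.

Lemma perm_on_setT (T : finType) (s : {perm T}) : perm_on setT s.
Proof. by apply/subsetP => x _; rewrite inE. Qed.

Lemma ctype_setTJ (T : finType) (s t : {perm T}) : perm_eq (ctype setT (s ^ t)%g) (ctype setT s).
Proof. by rewrite -{1}(imset_perm_on (perm_on_setT t)) ctypeJ. Qed.

(** Conjugating [s] by a fixed [u] permutes the class of [s], so the sum over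
    the two classes may be averaged over [u] first. *)
Lemma sum_kappa n mu nu (c : rat) :
  (forall s t : 'S_n, has_cycle_type s mu -> has_cycle_type t nu ->
     orbs_total setT s t = n`!%:R * c) ->
  \sum_(s : 'S_n | has_cycle_type s mu) \sum_(t : 'S_n | has_cycle_type t nu)
    (kappa (s * t)%g)%:R
  = (#|[set s : 'S_n | has_cycle_type s mu]| * #|[set t : 'S_n | has_cycle_type t nu]|)%:R * c.
Proof.
move=> H; set S := LHS.
have n0 : n`!%:R != 0 :> rat by rewrite pnatr_eq0 -lt0n fact_gt0.
apply: (mulfI n0).
transitivity (\sum_(u : 'S_n) S).
  rewrite sumr_const -[RHS]mulr_natl; congr (_%:R * _).
  by rewrite -card_Sn; apply: eq_card => u; rewrite inE.
transitivity (\sum_(s : 'S_n | has_cycle_type s mu) \sum_(t : 'S_n | has_cycle_type t nu)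
    orbs_total setT s t); last first.
  rewrite (eq_bigr (fun=> #|[set t : 'S_n | has_cycle_type t nu]|%:R * (n`!%:R * c))).
    rewrite sumr_const -[LHS]mulr_natl natrM !cardsE; ring.
  move=> s sm; rewrite (eq_bigr (fun=> n`!%:R * c)); last by move=> t; apply: H.
  by rewrite sumr_const -[LHS]mulr_natl cardsE.
rewrite /orbs_total.
under [RHS]eq_bigr => s _ do rewrite exchange_big.
rewrite [RHS]exchange_big /=; apply: eq_big => [u|u _].
  by apply/esym; exact: perm_on_setT.
rewrite /S (reindex_inj (conjg_inj u)) /=; apply: eq_big => [s|s _].
  by rewrite !has_cycle_typeE (permPl (ctype_setTJ s u)).
by apply: eq_bigr => t _; rewrite orbs_setT.
Qed.

Lemma main_term n p q r e : n = (p + q)%N -> (r < q)%N ->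
  n`!%:R * ((-1) ^+ (e + (n - p - r))
       / (n%:R * 'C(n - p - 1, r)%:R * 'C(n - 1, p)%:R))
  = - (p`!%:R * ((-1) ^+ e * alt_fact q r)) :> rat.
Proof.
move=> npq rq; have [u qu] : exists u, q = (r + u.+1)%N by exists (q - r).-1; lia.
have -> : (n - p - r = u.+1)%N by lia.
have -> : (n - p - 1 = r + u)%N by lia.
have -> : (n - 1 = p + (r + u))%N by lia.
have nE : n = (p + (r + u)).+1 by lia.
have uE : ((q - r).-1 = u)%N by lia.
rewrite /alt_fact uE.
have F m : m`!%:R != 0 :> rat by rewrite pnatr_eq0 -lt0n fact_gt0.
have b1 := bin_fact (leq_addr u r); have b2 := bin_fact (leq_addr (r + u) p).
rewrite addKn in b1; rewrite addKn in b2.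
have C1 : 'C(r + u, r)%:R != 0 :> rat by rewrite pnatr_eq0 -lt0n bin_gt0 leq_addr.
have C2 : 'C(p + (r + u), p)%:R != 0 :> rat by rewrite pnatr_eq0 -lt0n bin_gt0 leq_addr.
have n0 : n%:R != 0 :> rat by rewrite nE pnatr_eq0.
have -> : n`!%:R = n%:R * ('C(p + (r + u), p)%:R * (p`!%:R * ('C(r + u, r)%:R * (r`!%:R * u`!%:R)))) :> rat.
  by rewrite -!natrM b1 b2 {1}nE factS -nE.
rewrite exprD exprS natrM.
by field; rewrite n0 C1 C2.
Qed.

Lemma orbs_total_two n p q d (mu : d.-tuple nat) (s t : 'S_n) :
  (0 < p)%N -> (p < q)%N -> n = (p + q)%N -> sumn mu = n ->
  (forall i, (p < tnth mu i)%N) ->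
  has_cycle_type s mu -> has_cycle_type t [:: p; q] ->
  orbs_total setT s t = n`!%:R * (harmonic_number n
    + 1 / n.+1%:R * (1 + (-1) ^+ (n - d) / n%:R + (-1) ^+ p / 'C(n, p.-1)%:R
        + (-1) ^+ (n - d - p) / 'C(n, p)%:R)
    - \sum_(S : {set 'I_d} | S \proper [set: 'I_d])
       let Sigma := (\sum_(i in S) tnth mu i)%N in
       (-1) ^+ ((d - #|S|) + (n - p - Sigma))
       / (n%:R * 'C(n - p - 1, Sigma)%:R * 'C(n - 1, p)%:R)).
Proof.
move=> p0 pq npq smu mup; rewrite !has_cycle_typeE => cs ct.
have allp : all (ltn p) mu by apply/allP => k /tnthP[i ->]; apply: mup.
have U : universal setT t.
  by apply: (universal_two p0 _ (perm_on_setT t) ct); lia.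
rewrite universalE ?perm_on_setT // cardsT card_ord.
have -> : pairing n (chi (ctype setT s)) (halfchi (ctype setT t)) = pairing n (chi mu) (halfchi [:: p; q]).
  by apply: eq_pairing => a b c; apply: perm_pmuls.
have -> : pairing n (chi mu) (halfchi [:: p; q]) =
  - (-1) ^+ size mu * \sum_(1 <= k < p) alt_fact n k
  - \sum_(q <= k < n) alt_fact n k
  - p`!%:R * \sum_(k < q) alt_fact q k * (subset_poly mu)`_k
  - (-1) ^+ p * (q`! * p.-1`!)%:R.
  by rewrite npq pairing_two // -npq.
rewrite (sum_subset_poly (alt_fact q) (etrans smu npq)) // size_tuple.
have dp : (d * p.+1 <= n)%N.
  rewrite -smu sumnE big_tuple -[d in (d * _)%N]card_ord -sum_nat_const.
  by apply: leq_sum => i _; apply: mup.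
have nf : n`!%:R != 0 :> rat by rewrite pnatr_eq0 -lt0n fact_gt0.
have n1 : n.+1%:R != 0 :> rat by rewrite pnatr_eq0.
have bin a b : (a + b = n)%N -> 'C(n, a)%:R^-1 = (a`! * b`!)%:R / n`!%:R :> rat.
  move=> abn; have an : (a <= n)%N by lia.
  have := bin_fact an; have -> : (n - a = b)%N by lia.
  move=> e; rewrite -e !natrM; have := bin_gt0 n a; rewrite an => C0.
  have C1 : 'C(n, a)%:R != 0 :> rat by rewrite pnatr_eq0 -lt0n.
  have a1 : a`!%:R != 0 :> rat by rewrite pnatr_eq0 -lt0n fact_gt0.
  have b1 : b`!%:R != 0 :> rat by rewrite pnatr_eq0 -lt0n fact_gt0.
  by field; rewrite C1 a1 b1.
have main : n`!%:R * \sum_(S : {set 'I_d} | S \proper [set: 'I_d])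
       (let Sigma := (\sum_(i in S) tnth mu i)%N in
       (-1) ^+ ((d - #|S|) + (n - p - Sigma))
       / (n%:R * 'C(n - p - 1, Sigma)%:R * 'C(n - 1, p)%:R)) =
  - (p`!%:R * \sum_(S : {set 'I_d} | S \proper [set: 'I_d])
     (-1) ^+ (d - #|S|) * alt_fact q (\sum_(i in S) tnth mu i)%N).
  rewrite !mulr_sumr -sumrN; apply: eq_bigr => S SP /=.
  have := proper_parts_lt (etrans smu npq) mup SP.
  set r := (\sum_(i in S) tnth mu i)%N => rq.
  exact: main_term.
rewrite mulrBr main.
set sS := \sum_(S : {set 'I_d} | S \proper _) _.
have h1 : n.+1%:R * \sum_(1 <= k < p) alt_fact n k =
    (-1) ^+ q * (p`! * q`!)%:R - (-1) ^+ n.-1 * n.-1`!%:R.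
  rewrite alt_fact_sum; last by lia.
  by rewrite (_ : 1`! = 1)%N // mul1n subn1 npq addKn.
have h2 : n.+1%:R * \sum_(q <= k < n) alt_fact n k =
    n`!%:R - (-1) ^+ p * (q`! * p`!)%:R.
  rewrite alt_fact_sum; last by lia.
  by rewrite subnn expr0 mul1r fact0 muln1 npq addnK.
have pn : (0 < n)%N by lia.
have h3 : n%:R^-1 = n.-1`!%:R / n`!%:R :> rat by rewrite -[n%:R]/(n%:R) -{1}(bin1 n) (bin 1%N n.-1) ?fact0 ?mul1n //; lia.
rewrite h3 (bin p.-1 q.+1) ?(bin p q); [|lia|lia].
apply: (mulfI n1).
set s1 := \sum_(1 <= k < p) _ in h1 *; set s2 := \sum_(q <= k < n) _ in h2 *.
(* With [n = d + p + l] all signs become monomials in [(-1)^d], [(-1)^p],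
   [(-1)^l]. *)
have [l nl] : exists l, n = (d + p + l)%N.
  have d0 : (0 < d)%N by rewrite -(size_tuple mu); case: (tval mu) smu => //=; lia.
  have dpn : (d + p <= n)%N by nia.
  by exists (n - d - p)%N; lia.
have ql : q = (d + l)%N by lia.
have -> : (n - d - p = l)%N by lia.
have -> : (n - d = p + l)%N by lia.
have X2 : (-1) ^+ d * (-1) ^+ d = 1 :> rat by rewrite -exprD addnn -mul2n exprM sqrrN expr1n.
have sq : (-1) ^+ q = (-1) ^+ d * (-1) ^+ l :> rat by rewrite ql exprD.
have sn : (-1) ^+ n.-1 = - ((-1) ^+ d * (-1) ^+ p * (-1) ^+ l) :> rat.
  by rewrite -!exprD -nl -{2}(prednK pn) exprS mulN1r opprK.
rewrite sq sn in h1.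
have f1 : q.+1`!%:R = (n.+1%:R - p%:R) * q`!%:R :> rat.
  by rewrite factS natrM -natrB; [congr (_%:R * _); lia | lia].
have f2 : p`!%:R = p%:R * p.-1`!%:R :> rat by rewrite -natrM -[in LHS](prednK p0) factS prednK.
rewrite natrM in h1; rewrite natrM in h2.
rewrite (natrM _ p.-1`! q.+1`!) (natrM _ p`! q`!) (natrM _ q`! p.-1`!).
have g1 : s1 = ((-1) ^+ d * (-1) ^+ l * (p`!%:R * q`!%:R)
   + (-1) ^+ d * (-1) ^+ p * (-1) ^+ l * n.-1`!%:R) / n.+1%:R.
  by apply: (mulfI n1); rewrite h1 mulNr opprK [RHS]mulrC divfK.
have g2 : s2 = (n`!%:R - (-1) ^+ p * (q`!%:R * p`!%:R)) / n.+1%:R.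
  by apply: (mulfI n1); rewrite h2 [RHS]mulrC divfK //.
rewrite g1 g2 f1.
move: X2 n1 nf; rewrite exprD f2.
move: ((-1) ^+ d) ((-1) ^+ p) ((-1) ^+ l) => X Y Z X2 n1 nf.
have nq : n.+1%:R = p%:R + q.+1%:R :> rat by rewrite -natrD; congr _%:R; lia.
(* This rewrites the last boundary term over the common denominator [n + 1]. *)
have -> : q`!%:R * p.-1`!%:R = (p.-1`!%:R * ((n.+1%:R - p%:R) * q`!%:R)
    + p%:R * p.-1`!%:R * q`!%:R) / n.+1%:R :> rat.
  by apply: (mulfI n1); rewrite [RHS]mulrC divfK //; ring.
move: n1 nf; clear -X2; move: (n.+1%:R) (n`!%:R) => m N n1 nf.
have XX u v : - X * ((X * Z * u + X * Y * Z * v) / m) = - ((Z * u + Y * Z * v) / m).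
  by rewrite -[RHS]mul1r -X2; ring.
rewrite XX; move: (p%:R) (n.-1`!%:R) (p.-1`!%:R) (q`!%:R) => a1 a2 a3 a4.
by field; rewrite nf n1.
Qed.

(** Connectedness is automatic, and the third component is determined. *)
Lemma bicolored_mapsE n p d (mu : d.-tuple nat) (s t u : 'S_n) :
  (0 < n)%N -> (forall i, (p < tnth mu i)%N) ->
  ((s, t, u) \in bicolored_maps p n mu) =
  [&& u == (s * t)%g, has_cycle_type t [:: p; (n - p)%N] & has_cycle_type s mu].
Proof.
move=> n0 mup; rewrite inE /connected_bicolored_map; case: eqP => //= _.
case: (boolP (has_cycle_type t _)) => [ht|]; last by rewrite andbF.
case: (boolP (has_cycle_type s mu)) => [hs|]; last by rewrite !andbF.
rewrite !andbT; apply/idP; apply: (@map_transitive n p (n - p)%N) => //; first by rewrite -has_cycle_typeE.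
move=> z; have : #|porbit s z| \in tval mu.
  rewrite has_cycle_typeE in hs; rewrite -(perm_mem hs); apply: map_f.
  by rewrite mem_enum mem_orbs ?inE.
by case/tnthP => i ->.
Qed.

Lemma sum_bicolored_maps n p d (mu : d.-tuple nat) (F : 'S_n * 'S_n * 'S_n -> rat) :
  (0 < n)%N -> (forall i, (p < tnth mu i)%N) ->
  \sum_(m in bicolored_maps p n mu) F m =
  \sum_(s : 'S_n | has_cycle_type s mu)
    \sum_(t : 'S_n | has_cycle_type t [:: p; (n - p)%N]) F (s, t, (s * t)%g).
Proof.
move=> n0 mup; rewrite pair_big_dep /=.
rewrite (reindex_onto (fun st : 'S_n * 'S_n => (st.1, st.2, (st.1 * st.2)%g))
   (fun m => m.1)) /=.
  by apply: eq_bigl => -[s t] /=; rewrite (bicolored_mapsE _ _ _ n0 mup) !eqxx andbT /= andbC.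
by move=> [[s t] u]; rewrite (bicolored_mapsE _ _ _ n0 mup) => /andP[/eqP -> _].
Qed.

Theorem proposition3p7 (n p d : nat) (mu : d.-tuple nat)
    (p_gt0 : (0 < p)%N) (hnp : (2 * p + 2 <= n)%N)
    (mu_part : is_partition n mu)
    (mu_ge : forall i : 'I_d, (p.+1 <= tnth mu i)%N) :
  uniform_expectation (bicolored_maps p n mu) (@genus n) =
  1 / 2 *
  (n%:R - d%:R - harmonic_number n
   - 1 / (n.+1)%:R *
     (1 + (-1) ^+ (n - d) / n%:R
        + (-1) ^+ p / 'C(n, p.-1)%:R
        + (-1) ^+ (n - d - p) / 'C(n, p)%:R)
   + \sum_(S : {set 'I_d} | S \proper [set: 'I_d])
       let Sigma := (\sum_(i in S) tnth mu i)%N in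
       (-1) ^+ ((d - #|S|) + (n - p - Sigma))
       / (n%:R * 'C(n - p - 1, Sigma)%:R * 'C(n - 1, p)%:R)).
Proof.
have [_ mu0 /eqP smu] := and3P mu_part.
have n0 : (0 < n)%N by lia.
have pq : (p < n - p)%N by lia.
have npq : n = (p + (n - p))%N by lia.
set c := harmonic_number n + 1 / n.+1%:R * (1 + (-1) ^+ (n - d) / n%:R
   + (-1) ^+ p / 'C(n, p.-1)%:R + (-1) ^+ (n - d - p) / 'C(n, p)%:R)
   - \sum_(S : {set 'I_d} | S \proper [set: 'I_d])
       let Sigma := (\sum_(i in S) tnth mu i)%N in
       (-1) ^+ ((d - #|S|) + (n - p - Sigma))
       / (n%:R * 'C(n - p - 1, Sigma)%:R * 'C(n - 1, p)%:R).
have sk := @sum_kappa n mu [:: p; (n - p)%N] c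
   (fun s t => @orbs_total_two n p (n - p)%N d mu s t p_gt0 pq npq smu mu_ge).
set a := #|[set s : 'S_n | has_cycle_type s mu]| in sk.
set b := #|[set t : 'S_n | has_cycle_type t [:: p; (n - p)%N]]| in sk.
have ex r : all (leq 1) r -> sumn r = n -> (0 < #|[set s : 'S_n | has_cycle_type s r]|)%N.
  move=> r0 sr; have [|s _ cs] := @exists_ctype [the finType of 'I_n] [set: 'I_n] r r0.
    by rewrite cardsT card_ord.
  by rewrite card_gt0; apply/set0Pn; exists s; rewrite inE has_cycle_typeE.
have a0 : (0 < a)%N by exact: ex.
have b0 : (0 < b)%N by apply: ex; rewrite /= ?addn0 -?npq // p_gt0; lia.
have card : #|bicolored_maps p n mu|%:R = (a * b)%:R :> rat.
  rewrite -sum1_card natr_sum (sum_bicolored_maps _ n0 mu_ge).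
  rewrite (eq_bigr (fun=> b%:R)); last first.
    by move=> s _; rewrite sumr_const /b cardsE.
  by rewrite sumr_const /a cardsE -[LHS]mulr_natl natrM.
rewrite /uniform_expectation card (sum_bicolored_maps _ n0 mu_ge).
have -> : \sum_(s : 'S_n | has_cycle_type s mu)
    \sum_(t : 'S_n | has_cycle_type t [:: p; (n - p)%N]) genus (s, t, (s * t)%g)
  = (a * b)%:R * (n%:R - d%:R - c) / 2.
  transitivity (\sum_(s : 'S_n | has_cycle_type s mu)
    \sum_(t : 'S_n | has_cycle_type t [:: p; (n - p)%N])
      ((n%:R - d%:R) / 2 - (kappa (s * t)%g)%:R / 2 : rat)).
    apply: eq_bigr => s hs; apply: eq_bigr => t ht; rewrite /genus.
    rewrite has_cycle_typeE in hs; rewrite has_cycle_typeE in ht.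
    by rewrite (kappaE hs) (kappaE ht) size_tuple [size _]/=; field.
  rewrite (eq_bigr (fun s : 'S_n => b%:R * ((n%:R - d%:R) / 2) -
    (\sum_(t : 'S_n | has_cycle_type t [:: p; (n - p)%N]) (kappa (s * t)%g)%:R) / 2 : rat)).
    rewrite sumrB sumr_const -mulr_suml sk -[X in X - _]mulr_natl /a cardsE natrM.
    by ring.
  by move=> s _; rewrite sumrB sumr_const -mulr_suml -[X in X - _]mulr_natl /b cardsE.
have ab0 : (a * b)%:R != 0 :> rat by rewrite pnatr_eq0 -lt0n muln_gt0 a0.
have G (x y : rat) : x != 0 -> x * y / 2 / x = 1 / 2 * y.
  by move=> x0; field.
rewrite G // /c; congr (_ * _).
by rewrite !opprD opprK !addrA.
Qed.
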